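(* Let $\Phi$ be an associative commutative ring with $1$, and let $A$ be a finitely generated associative commutative $\Phi$-algebra that is a domain. Let $L$ be a Lie subalgebra of $\mathrm{Der}(A)$. If the subalgebra $A_L$ is an order in $A$, then the Lie algebra $L$ is locally nilpotent.
   Context: $\mathrm{Der}(A)$ is the Lie $\Phi$-algebra of $\Phi$-linear derivations of $A$ under the commutator bracket (for $\Phi=\mathbb{Z}$ this is the Lie ring of all derivations of the ring $A$). For a subalgebra $L\subseteq\mathrm{Der}(A)$, put $$A_L=\{a\in A \mid \text{for every } d\in L \text{ there exists an integer } n(d)\ge 1 \text{ such that } d^{n(d)}(a)=0\};$$ this is a subalgebra of $A$. A subalgebra $B$ of an associative commutative algebra $A$ is called an order in $A$ if there exists a multiplicative semigroup $S\subset B$ such that (1) every element of $S$ is invertible in $A$, and (2) every element $a\in A$ can be represented as $a=s^{-1}b$ with $s\in S$ and $b\in B$. A Lie algebra is locally nilpotent if every finitely generated subalgebra is nilpotent. *)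

(* Defs.v *)
From mathcomp Require Import all_boot all_algebra.
From mathcomp Require Import boolp classical_sets functions cardinality.
From mathcomp Require Import ring.

Set Implicit Arguments.
Unset Strict Implicit.
Unset Printing Implicit Defensive.

Import GRing.Theory.

Local Open Scope classical_set_scope.
Local Open Scope ring_scope.

Section Derivations.
Variables (Phi : comPzRingType) (A : comUnitAlgType Phi).

Implicit Types (B S G : set A) (L M X : set (A -> A)) (d e : A -> A).

Definition subalgebra B : Prop := @GRing.subalg_closed Phi A [in B].

(* Since subalgebras contain 1, generation is as a unital algebra; for a ring
   with 1 this is the same as finite generation without 1: add 1 to G. *)
Definition fin_gen_algebra : Prop :=
  exists2 G : set A, finite_set G & smallest subalgebra G = [set: A].

(* Lie algebras of derivations are sets of maps A -> A, with the pointwise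
   Phi-module structure of A -> A and the commutator bracket. *)
Definition Der : set (A -> A) :=
  [set d | linear d /\ forall a b : A, d (a * b) = d a * b + a * d b].

Definition lie_bracket d e : A -> A := fun a => d (e a) - e (d a).

Definition submodule M : Prop := @GRing.submod_closed Phi (A -> A) [in M].

Definition lie_closed M : Prop :=
  submodule M /\ forall d e, M d -> M e -> M (lie_bracket d e).

Definition lie_subalgebra M L : Prop := M `<=` L /\ lie_closed M.

Definition fin_gen_lie M : Prop :=
  exists2 X, finite_set X & M = smallest lie_closed X.

(* [X, M] is the Phi-submodule spanned by the brackets. *)
Definition lie_product X M : set (A -> A) :=
  smallest submodule [set lie_bracket d e | d in X & e in M].

Definition lower_central M (n : nat) : set (A -> A) :=
  iter n (fun X => lie_product X M) M.

Definition lie_nilpotent M : Prop :=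
  exists n, lower_central M n = [set 0].

Definition locally_nilpotent L : Prop :=
  forall M, lie_subalgebra M L -> fin_gen_lie M -> lie_nilpotent M.

Definition nil_part L : set A :=
  [set a | forall d, L d -> exists2 n, (1 <= n)%N & iter n d a = 0].

(* S is automatically nonempty, by the last clause. *)
Definition is_order B : Prop :=
  subalgebra B /\
  exists S,
    [/\ S `<=` B,
        forall s t, S s -> S t -> S (s * t),
        forall s, S s -> s \is a GRing.unit
      & forall a, exists s b, [/\ S s, B b & a = s^-1 * b]].

Lemma lie_closed_Der : lie_closed Der.
Proof.
split.
  split=> [|k d e]; rewrite ?in_setE.
    split=> [k x y|a b]; first by rewrite scaler0 addr0.
    by rewrite mul0r mulr0 addr0.
  move=> [dl dM] [el eM]; split=> [h x y|a b]; rewrite !fctE ?dl ?el ?dM ?eM.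
    by rewrite !scalerDr !scalerA (mulrC k h) addrACA.
  by rewrite scalerDr mulrDl mulrDr -scalerAl -scalerAr addrACA.
move=> d e [dl dM] [el eM]; rewrite /lie_bracket.
split=> [h x y|a b].
  by rewrite !el !dl scalerBr !el opprD addrACA.
have addl (f : A -> A) : linear f -> {morph f : x y / x + y}.
  by move=> fl x y; rewrite -[x]scale1r fl !scale1r.
by rewrite !dM !eM !(addl _ dl) !(addl _ el) !dM !eM; ring.
Qed.

Lemma subalgebra_nil_part L : L `<=` Der -> subalgebra (nil_part L).
Proof.
move=> LD.
have addl d : L d -> linear d by move=> /LD[].
have it0 d n : L d -> iter n d 0 = 0.
  move=> /addl dl; elim: n => //= n ->.
  by have := dl (-1) 0 0; rewrite scaler0 addr0 scaleN1r addNr.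
have itl d n : L d -> linear (iter n d).
  by move=> /addl dl k x y; elim: n => //= n ->; rewrite dl.
have mono d m n x : L d -> (m <= n)%N -> iter m d x = 0 -> iter n d x = 0.
  by move=> Ld mn dx; rewrite -(subnK mn) iterD dx it0.
split=> [|k a b|a b]; rewrite ?in_setE.
- move=> d Ld; exists 1%N => //=; have [_ dM] := LD _ Ld.
  by have /eqP := dM 1 1; rewrite !mulr1 mul1r -subr_eq subrr => /eqP.
- move=> Na Nb d Ld; have [m m1 am] := Na _ Ld; have [n n1 bn] := Nb _ Ld.
  exists (m + n)%N; first by rewrite addn_gt0 m1.
  rewrite itl // (mono _ _ _ _ Ld (leq_addr n m) am).
  by rewrite (mono _ _ _ _ Ld (leq_addl m n) bn) scaler0 addr0.
- move=> Na Nb d Ld; have [m m1 am] := Na _ Ld; have [n n1 bn] := Nb _ Ld.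
  exists (m + n)%N; first by rewrite addn_gt0 m1.
  have [_ dM] := LD _ Ld.
  have: (m + n <= m + n)%N by [].
  move: {-1}(m + n)%N => k.
  elim: k m n a b {m1 n1 Na Nb} am bn => [|k IH] m n a b am bn.
    rewrite leqn0 addn_eq0 => /andP[/eqP m0 _].
    by move: am; rewrite m0 /= => ->; rewrite mul0r.
  case: m am => [|m] am; first by rewrite (am : a = 0) mul0r it0.
  case: n bn => [|n] bn; first by rewrite (bn : b = 0) mulr0 it0.
  move=> mnk; rewrite iterSr dM -[d a * b]scale1r itl // scale1r.
  rewrite (IH m n.+1) ?scale1r ?add0r -?iterSr //.
  by rewrite (IH m.+1 n) -?iterSr // addSnnS.
Qed.

End Derivations.

Arguments fin_gen_algebra {Phi} A.
Arguments Der {Phi} A.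

(* Main.v *)
From HB Require Import structures.
Require Import Defs.
From mathcomp Require Import all_boot all_algebra all_field.
From mathcomp Require Import boolp classical_sets functions cardinality.
From mathcomp Require Import ring zify.

Set Implicit Arguments.
Unset Strict Implicit.
Unset Printing Implicit Defensive.

Import GRing.Theory.

Local Open Scope classical_set_scope.
Local Open Scope ring_scope.

(** Let [N_d] be the subring of the elements killed by some power of a derivation
    [d]. Since [A_L] is an order, [A] is generated over its constants by finitely
    many elements, each of which lies in [N_d] for all [d] in [L] or is the inverse
    of such an element ([order_tame_generators]). This is how the order enters.

    Suppose that [p = 0] in [A] for some positive integer [p]. Then [p]-th powers are
    constants. Hence [N_d] contains the inverses of its elements, so [N_d = A], and
    [A] is spanned over the constants by finitely many monomials. Engel's theorem for
    sets of locally nilpotent maps closed under brackets ([engel]) makes all products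
    of [n] elements of [L] vanish for some [n], and [L] is nilpotent.

    In characteristic zero, [L] is first shown to be solvable, with derived length at
    most the number [m] of generators ([derived_brackets_char0]). A derived bracket
    lives on a finitely generated subring [B] of [A]. For almost all primes [p], the
    ring [B] has a prime ideal [P] that contains [p], avoids a given nonzero element
    and is generated by [p] after localization at [P] ([has_reductions_adjoin], by
    induction on the generators of [B]); the last property makes [P] stable under
    derivations. On [B / P] the case of positive characteristic gives nilpotency. A
    nilpotent Lie algebra of derivations has a basis over the field of fractions in
    which each member is central modulo the span of the previous ones, and bracketing
    moves down this flag ([flag_abelian_step]). The flag has length at most [m], for
    every [p], so derived brackets of length [m] vanish ([derived_brackets_eq0]).

    Nilpotency itself does not pass back from [B / P], where its class may grow with [p].
    Instead, one climbs up the derived series. Let [J] be a locally nilpotent Lie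
    algebra in [L] normalized by [d] in [L], and [z] in [J]. For suitable positive
    integers [t] the conjugate of [d] by the exponential of [t z] lies in [L], so it
    is nilpotent at every [b] in [A_L]. Thus [d] is nilpotent at the exponential of
    [t z] applied to [b], a polynomial in [t], and so at its linear coefficient [z b]
    ([nil_at_of_conj_exp]). The same is true of all [(ad d) ^ i z], from which
    [(ad d) ^ N z = 0] for some [N] ([ad_nilpotent]), and then the Lie algebra spanned
    by [J] and [d] is locally nilpotent ([nilpotent_set_add_line]). *)

(** * Additive maps, brackets and words *)

Section AdditiveMaps.
Variable V : zmodType.
Implicit Types (f d e : V -> V) (L : set (V -> V)).

Definition bracket d e : V -> V := fun a => d (e a) - e (d a).

Definition word (w : seq (V -> V)) (x : V) : V := foldr (fun d y => d y) x w.

Definition bracket_closed L := forall d e, L d -> L e -> L (bracket d e).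

Definition additive_maps L := forall d, L d -> GRing.zmod_morphism d.

Section OneMap.
Variables (f : V -> V) (fA : GRing.zmod_morphism f).

Lemma map0 : f 0 = 0. Proof. by rewrite -[X in f X](subrr 0) fA subrr. Qed.
Lemma mapN x : f (- x) = - f x. Proof. by rewrite -sub0r fA map0 sub0r. Qed.
Lemma mapD x y : f (x + y) = f x + f y.
Proof. by rewrite -[y in LHS]opprK fA mapN opprK. Qed.
Lemma mapMn x n : f (x *+ n) = f x *+ n.
Proof. by elim: n => [|n IH]; rewrite ?map0 // !mulrS mapD IH. Qed.
Lemma map_sum I (r : seq I) P (F : I -> V) :
  f (\sum_(i <- r | P i) F i) = \sum_(i <- r | P i) f (F i).
Proof. exact: (big_morph f mapD map0). Qed.
Lemma iter_additive n : GRing.zmod_morphism (iter n f).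
Proof. by elim: n => // n IH x y; rewrite /= IH fA. Qed.
End OneMap.

Lemma iter_map0 f n : GRing.zmod_morphism f -> iter n f 0 = 0.
Proof. by move=> fA; apply/map0/iter_additive. Qed.

Lemma iter_eq0 f m n x : GRing.zmod_morphism f ->
  (m <= n)%N -> iter m f x = 0 -> iter n f x = 0.
Proof. by move=> fA mn fx; rewrite -(subnK mn) iterD fx iter_map0. Qed.

Lemma word_cat w1 w2 x : word (w1 ++ w2) x = word w1 (word w2 x).
Proof. by rewrite /word foldr_cat. Qed.

Lemma word_additive L w : additive_maps L -> all [in L] w ->
  GRing.zmod_morphism (word w).
Proof.
move=> LA; elim: w => [|d w IH] // /andP[/set_mem Ld /IH wA] x y.
by rewrite /= wA LA.
Qed.

Definition nil_at f x := exists n, iter n f x = 0.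

Lemma nil_atB f x y : GRing.zmod_morphism f ->
  nil_at f x -> nil_at f y -> nil_at f (x - y).
Proof.
move=> fA [m xm] [n yn]; exists (m + n)%N.
rewrite iter_additive // (iter_eq0 fA (leq_addr _ _) xm).
by rewrite (iter_eq0 fA (leq_addl _ _) yn) subrr.
Qed.

Definition killed_by_words L n := forall w, all [in L] w -> size w = n ->
  forall x, word w x = 0.

Lemma killed_by_words_ge L n : additive_maps L -> killed_by_words L n ->
  forall w, all [in L] w -> (n <= size w)%N -> forall x, word w x = 0.
Proof.
move=> LA Ln w Lw nw x; rewrite -(cat_take_drop n w) word_cat.
apply: Ln; last by rewrite size_takel.
by move: Lw; rewrite -{1}(cat_take_drop n w) all_cat => /andP[].
Qed.

(** If products of [n] elements of [W] vanish, then so do the brackets of an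
    additive map with [2 n] elements of [W]: expand the brackets, and each term
    has [n] factors on one side of the map. So forming brackets with [W] while
    remaining outside [T] must stop, at a map whose brackets with [W] are all in
    [T]. *)
Lemma exists_normalizing (W T : set (V -> V)) n x0 :
    additive_maps W -> killed_by_words W n ->
    GRing.zmod_morphism x0 -> (forall f, (forall x, f x = 0) -> T f) ->
  ~ T x0 -> forall K : set (V -> V), K x0 ->
    (forall w x, W w -> K x -> K (bracket w x) /\ K (bracket x w)) ->
  exists x, [/\ K x, ~ T x
    & forall w, W w -> T (bracket w x) /\ T (bracket x w)].
Proof.
move=> WA Wn x0A T0 nT K Kx0 Kbr.
pose Q k f := [/\ K f, ~ T f & forall w1 w2, all [in W] w1 -> all [in W] w2 ->
  (n.*2 <= size w1 + size w2 + k)%N -> forall x, word w1 (f (word w2 x)) = 0].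
apply: contrapT => noX.
have step k f : Q k f -> exists g, Q k.+1 g.
  move=> [Kf nTf Qf].
  have [w [Ww nT2]] : exists w, W w /\ ~ (T (bracket w f) /\ T (bracket f w)).
    apply: contrapT => nw; apply: noX; exists f; split=> // w Ww.
    by apply: contrapT => h; apply: nw; exists w.
  have [Kwf Kfw] := Kbr w f Ww Kf.
  have aux : forall w1 w2, all [in W] w1 -> all [in W] w2 ->
    (n.*2 <= size w1 + size w2 + k.+1)%N -> forall x,
    word w1 (w (f (word w2 x))) = 0 /\ word w1 (f (w (word w2 x))) = 0.
    move=> w1 w2 Ww1 Ww2 sz x; split.
      rewrite -[LHS]/(word w1 (word [:: w] _)) -word_cat.
      apply: Qf; rewrite ?all_cat ?Ww1 ?size_cat //= ?mem_set //.
      by move: sz; lia.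
    rewrite -[w (word w2 x)]/(word (w :: w2) x).
    by apply: Qf; rewrite //= ?mem_set //; move: sz; lia.
  case: (pselect (T (bracket w f))) => [Twf|nTwf].
    exists (bracket f w); split=> // [h|w1 w2 Ww1 Ww2 sz x]; first exact: nT2.
    have [h1 h2] := aux _ _ Ww1 Ww2 sz x.
    by rewrite /bracket (word_additive WA Ww1) h1 h2 subrr.
  exists (bracket w f); split=> // w1 w2 Ww1 Ww2 sz x.
  have [h1 h2] := aux _ _ Ww1 Ww2 sz x.
  by rewrite /bracket (word_additive WA Ww1) h1 h2 subrr.
have Qk k : exists f, Q k f.
  elim: k => [|k [f Qf]]; last exact: step Qf.
  exists x0; split=> // w1 w2 Ww1 Ww2; rewrite addn0 => sz x.
  have [h|h] := leqP n (size w1); first exact: (killed_by_words_ge WA Wn).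
  rewrite (killed_by_words_ge WA Wn Ww2); last by lia.
  by rewrite map0 // (map0 (word_additive WA Ww1)).
have [f [_ nTf Qf]] := Qk n.*2.
by apply: nTf; apply: T0 => x; exact: (Qf [::] [::]).
Qed.

End AdditiveMaps.

(** * Linear dependence over a subring of a domain *)

Section Subrings.
Variable R : comNzRingType.
Implicit Types (C : set R).

Definition subring C :=
  [/\ C 1, forall x y, C x -> C y -> C (x - y)
     & forall x y, C x -> C y -> C (x * y)].

Variables (C : set R) (Csub : subring C).

Lemma subring1 : C 1. Proof. by case: Csub. Qed.
Lemma subringB x y : C x -> C y -> C (x - y). Proof. by case: Csub => _ + _; exact. Qed.
Lemma subringM x y : C x -> C y -> C (x * y). Proof. by case: Csub => _ _; exact. Qed.
Lemma subring0 : C 0. Proof. by rewrite -(subrr 1); apply: subringB subring1 subring1. Qed.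
Lemma subringN x : C x -> C (- x). Proof. by rewrite -sub0r; apply: subringB subring0. Qed.
Lemma subringD x y : C x -> C y -> C (x + y).
Proof. by move=> Cx Cy; rewrite -[y]opprK; apply/subringB/subringN. Qed.
Lemma subringX x n : C x -> C (x ^+ n).
Proof.
move=> Cx; elim: n => [|n IH]; first by rewrite expr0; exact: subring1.
by rewrite exprS; exact: subringM.
Qed.
Lemma subring_sum I (r : seq I) (P : pred I) (F : I -> R) :
  (forall i, P i -> C (F i)) -> C (\sum_(i <- r | P i) F i).
Proof. by move=> CF; elim/big_ind: _ => //; [exact: subring0 | exact: subringD]. Qed.
End Subrings.

Arguments subring {R} C.

Section Dependence.
Variables (R : comNzRingType) (R_domain : GRing.integral_domain_axiom R).

Lemma domain_eq0 (x y : R) : x != 0 -> x * y = 0 -> y = 0.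
Proof. by move=> /negPf x0 /R_domain; rewrite x0 => /eqP. Qed.

Lemma domain_mulf_neq0 (x y : R) : x != 0 -> y != 0 -> x * y != 0.
Proof. by move=> x0 y0; apply/eqP => /(domain_eq0 x0)/eqP; rewrite (negPf y0). Qed.

(** Elimination without division: a nonzero entry in the last column serves as a
    pivot; if there is none, this column and one row can be dropped. *)
Lemma dependent_rows (C : set R) (Csub : subring C) n (x : 'I_n.+1 -> 'I_n -> R) :
    (forall i j, C (x i j)) ->
  exists c : 'I_n.+1 -> R, [/\ forall i, C (c i), exists i, c i != 0
    & forall j, \sum_i c i * x i j = 0].
Proof.
elim: n x => [|n IH] x Cx.
  exists (fun=> 1); split=> [i||[]//]; first exact: subring1.
  by exists ord0; exact: oner_neq0.
have [x0|] := pselect (forall i, x i ord_max = 0).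
  have [c [Cc [i ci0] cx]] := IH (fun i j => x (lift ord0 i) (lift ord_max j))
    (fun _ _ => Cx _ _).
  exists (fun i => if unlift ord0 i is Some i' then c i' else 0); split=> [k||j].
  - by case: unliftP => [k' _|_]; [exact: Cc | exact: subring0].
  - by exists (lift ord0 i); rewrite liftK.
  - rewrite (bigD1_ord ord0) //= unlift_none mul0r add0r.
    case: (unliftP ord_max j) => [j' ->|->].
      by rewrite -[RHS](cx j'); apply: eq_bigr => k _; rewrite liftK.
    by rewrite big1 // => k _; rewrite x0 mulr0.
move=> /existsNP[i0 /eqP a0]; set a := x i0 ord_max in a0.
pose y i j := a * x (lift i0 i) (lift ord_max j)
  - x (lift i0 i) ord_max * x i0 (lift ord_max j).
have Cy i j : C (y i j) by apply: (subringB Csub); apply: (subringM Csub); apply: Cx.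
have [c [Cc [i ci0] cy]] := IH y Cy.
exists (fun i => if unlift i0 i is Some i' then a * c i'
  else - \sum_k c k * x (lift i0 k) ord_max); split=> [k||j].
- case: unliftP => [k' _|_]; first by apply: (subringM Csub); [apply: Cx|apply: Cc].
  apply/(subringN Csub)/(subring_sum Csub) => l _.
  by apply: (subringM Csub); [apply: Cc|apply: Cx].
- by exists (lift i0 i); rewrite liftK domain_mulf_neq0.
- rewrite (bigD1_ord i0) //= unlift_none mulNr mulr_suml.
  under [X in _ + X]eq_bigr do rewrite liftK.
  rewrite addrC -sumrB.
  case: (unliftP ord_max j) => [j' ->|->].
    by rewrite -[RHS](cy j'); apply: eq_bigr => k _; rewrite /y; ring.
  by rewrite big1 // => k _; rewrite -/a; ring.
Qed.

Lemma dependent_spanned (C : set R) (Csub : subring C) n (v : 'I_n -> R)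
    (u : 'I_n.+1 -> R) :
    (forall i, exists a : 'I_n -> R,
       (forall j, C (a j)) /\ u i = \sum_j a j * v j) ->
  exists c : 'I_n.+1 -> R, [/\ forall i, C (c i), exists i, c i != 0
    & \sum_i c i * u i = 0].
Proof.
move=> /choice[a ua].
have [c [Cc c0 cx]] := dependent_rows Csub (fun i => (ua i).1).
exists c; split=> //.
under eq_bigr do rewrite (ua _).2 mulr_sumr.
rewrite exchange_big big1 //= => j _.
by under eq_bigr do rewrite mulrA; rewrite -mulr_suml cx mul0r.
Qed.

End Dependence.

(** * Engel's theorem for locally nilpotent maps *)

Section Engel.
Variables (R : comNzRingType) (R_domain : GRing.integral_domain_axiom R).
Variable (C : set R).
Implicit Types (L W : set (R -> R)).

Definition linear_over L := forall d, L d -> forall c x, C c -> d (c * x) = c * d x.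

Definition dependent_over n := forall u : 'I_n.+1 -> R,
  exists c : 'I_n.+1 -> R, [/\ forall i, C (c i), exists i, c i != 0
    & \sum_i c i * u i = 0].

Lemma word_linear_over L w : linear_over L -> all [in L] w ->
  forall c x, C c -> word w (c * x) = c * word w x.
Proof.
move=> LC; elim: w => //= d w IH /andP[/set_mem Ld Lw] c x Cc.
by rewrite IH // LC.
Qed.

(** Choosing, for each [k <= n], a vector killed by all words of length [k.+1] but not
    by all words of length [k] gives [n.+1] vectors; a word of length [k] applied to a
    relation between them isolates its last term. *)
Lemma killed_by_words_of_flag L n : additive_maps L -> linear_over L ->
    dependent_over n ->
    (forall k, (k <= n)%N ->
     (exists2 w, all [in L] w & size w = k /\ exists x, word w x != 0) ->
     exists v, (exists2 w, all [in L] w & size w = k /\ word w v != 0) /\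
       forall w, all [in L] w -> size w = k.+1 -> word w v = 0) ->
  killed_by_words L n.
Proof.
move=> LA LC dep flag.
apply: contrapT => nkill.
have long : exists2 w, all [in L] w & size w = n /\ exists x, word w x != 0.
  apply: contrapT => h; apply: nkill => w Lw sw x; apply/eqP/negPn/negP => wx.
  by apply: h; exists w => //; split=> //; exists x.
have short k : (k <= n)%N ->
    exists2 w, all [in L] w & size w = k /\ exists x, word w x != 0.
  move=> kn; have [w Lw [sw [x wx]]] := long; exists (take k w).
    by move: Lw; rewrite -{1}(cat_take_drop k w) all_cat => /andP[].
  split; first by rewrite size_takel ?sw.
  by exists (word (drop k w) x); rewrite -word_cat cat_take_drop.
have /choice[u uP] : forall i : 'I_n.+1, exists v,
  (exists2 w, all [in L] w & size w = i /\ word w v != 0) /\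
  forall w, all [in L] w -> size w = i.+1 -> word w v = 0.
  by move=> i; apply: flag; [rewrite -ltnS|apply: short; rewrite -ltnS].
have [c [Cc [i0 ci0] cu]] := dep u.
have [i ci imax] : exists2 i, c i != 0 & forall j : 'I_n.+1, (i < j)%N -> c j = 0.
  have [i ci imax] := @arg_maxnP _ i0 (fun i => c i != 0) (fun i => nat_of_ord i) ci0.
  by exists i => // j ij; apply/eqP/negPn/negP => /imax; rewrite /= leqNgt ij.
have [[w Lw [sw wu]] _] := uP i.
have wA := word_additive LA Lw.
have /eqP := congr1 (word w) cu.
rewrite (map0 wA) (map_sum wA) (bigD1 i) //= big1 => [|j ji].
  rewrite addr0 (word_linear_over LC Lw) //.
  by apply/negP/domain_mulf_neq0.
rewrite (word_linear_over LC Lw) //.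
have [ij|ji'] := ltnP i j; first by rewrite imax // mul0r.
have [_ kill] := uP j.
have lji : (j < i)%N by rewrite ltn_neqAle ji' andbT.
have ->: word w (u j) = 0; last by rewrite mulr0.
rewrite -(cat_take_drop (i - j.+1) w) word_cat.
have /andP[Lt Ldr] : all [in L] (take (i - j.+1) w) && all [in L] (drop (i - j.+1) w).
  by rewrite -all_cat cat_take_drop.
rewrite kill ?(map0 (word_additive LA Lt)) // size_drop sw.
by lia.
Qed.

Definition or_zero W := [set f : R -> R | W f \/ forall x, f x = 0].

(** Let [U] be the set of vectors killed by the words of length [k]. Since words in [W]
    vanish from length [n] on, some vector outside [U] is sent into [U] by [W]. As [x]
    normalizes [W], this remains true of its images under [x]; the last of these outside
    [U] is also sent into [U] by [x]. *)
Lemma killed_by_words_add W x n : additive_maps (W `|` [set x]) ->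
    linear_over (W `|` [set x]) -> dependent_over n -> killed_by_words W n ->
    (forall y, nil_at x y) -> (forall w, W w -> or_zero W (bracket w x)) ->
  killed_by_words (W `|` [set x]) n.
Proof.
set W1 := W `|` [set x] => W1A W1C dep Wn xnil Wx.
apply: killed_by_words_of_flag => // k _ [w0 Lw0 [sw0 [y wy]]].
pose U z := forall w, all [in W1] w -> size w = k -> word w z = 0.
have nUy : ~ U y by move=> /(_ _ Lw0 sw0)/eqP; rewrite (negPf wy).
have UD z t : U z -> U t -> U (z + t).
  move=> Uz Ut w Lw sw.
  by rewrite (mapD (word_additive W1A Lw)) Uz // Ut // addr0.
have U0 : U 0 by move=> w Lw _; apply: map0 (word_additive W1A Lw).
have Ustable d z : W1 d -> U z -> U (d z).
  move=> W1d Uz [|e w] Lw sw.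
    by rewrite /= (Uz [::] isT sw : z = 0) (map0 (W1A _ W1d)).
  have := Uz (rcons w d); rewrite -cats1 word_cat all_cat size_cat /= addn1.
  move: Lw; rewrite [all _ (e :: w)]/= => /andP[/set_mem W1e Lw].
  rewrite Lw mem_set //= => /(_ isT sw) ->.
  exact: map0 (W1A _ W1e).
have [f [nUf Wf]] : exists f, ~ U f /\ forall w, W w -> U (w f).
  have : exists j f, ~ U f /\ forall v, all [in W] v -> size v = j -> U (word v f).
    by exists n, y; split=> // v Wv sv; rewrite Wn.
  case=> j; elim: j => [|j IH] [f [nUf Wf]]; first by case: nUf; apply: (Wf [::]).
  have [?|/existsNP[w /not_implyP[Ww nUw]]] := pselect (forall w, W w -> U (w f)).
    by exists f.
  apply: IH; exists (w f); split=> // v Wv sv.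
  rewrite -[w f]/(word [:: w] f) -word_cat.
  by apply: Wf; rewrite ?all_cat ?Wv ?size_cat /= ?mem_set // sv addn1.
have xA : GRing.zmod_morphism x by apply: W1A; right.
have [v [nUv Wv Uxv]] : exists v, [/\ ~ U v, forall w, W w -> U (w v) & U (x v)].
  have : exists N f, [/\ ~ U f, forall w, W w -> U (w f) & U (iter N x f)].
    by have [N xN] := xnil f; exists N, f; rewrite xN; split.
  case=> N; elim: N => [|N IH] [g [nUg Wg]]; first by [].
  rewrite iterSr => UN.
  have [Uxg|nUxg] := pselect (U (x g)); first by exists g.
  apply: IH; exists (x g); split=> // w Ww.
  have -> : w (x g) = x (w g) + bracket w x g by rewrite /bracket addrC subrK.
  apply: UD; first by apply: Ustable; [right | exact: Wg].
  by have [/Wg|->] := Wx w Ww.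
have [u Lu [su uv]] : exists2 u, all [in W1] u & size u = k /\ word u v != 0.
  apply: contrapT => h; apply: nUv => w Lw sw; apply/eqP/negPn/negP => wv.
  by apply: h; exists w.
exists v; split; first by exists u.
case/lastP=> // w d; rewrite -cats1 all_cat size_cat addn1 word_cat /= andbT.
move=> /andP[Lw /set_mem[Wd|->]] [sw]; first exact: Wv.
exact: Uxv.
Qed.

(** Choose a maximal subset of [L], closed under brackets up to zero, on which
    the conclusion holds. If it misses an element of [L], it misses one that
    normalizes it, and this one can be added. *)
Theorem engel L n : additive_maps L -> linear_over L -> bracket_closed L ->
    (forall d, L d -> forall x, nil_at d x) -> dependent_over n ->
  killed_by_words L n.
Proof.
move=> LA LC Lbr Lnil dep.
have n_gt0 : (0 < n)%N.
  rewrite lt0n; apply/eqP => n0; move: dep; rewrite n0 => /(_ (fun=> 1)).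
  move=> [c [_ [i ci]]]; rewrite big_ord_recl big_ord0 addr0 mulr1.
  by move=> c0; rewrite (ord1 i) c0 eqxx in ci.
pose P W := [/\ W `<=` L, forall d e, W d -> W e -> or_zero W (bracket d e)
  & killed_by_words W n].
have [|W [[WL Wbr Wn] Wmax]] := @Zorn_bigcup _ P.
  move=> F FP Ftot; split=> [d [X /FP[XL _ _] /XL]//| d e [X FX Xd] [Y FY Ye] |].
    (* Two members of a chain of sets lie in one of them, and so do [n > 0] members. *)
    have [X' [FX' X'd X'e]] : exists X', [/\ F X', X' d & X' e].
      case: (Ftot X Y FX FY) => [XY|YX]; first by exists Y; split=> //; apply: XY.
      by exists X; split=> //; apply: YX.
    have [_ /(_ _ _ X'd X'e) h _] := FP _ FX'.
    by case: h => [h|]; [left; exists X' | right].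
  move=> w Lw sw.
  have [X FX Xw] : exists2 X, F X & all [in X] w.
    have: w <> [::] by move=> w0; move: sw n_gt0; rewrite w0 /= => <-.
    elim: w Lw {sw} => // d [|e w] IH /andP[/set_mem[X FX Xd] Lw] _.
      by exists X; rewrite //= mem_set.
    have [//|Y FY Yw] := IH Lw.
    case: (Ftot X Y FX FY) => [XY|YX].
      by exists Y => //; apply/andP; split; [exact/mem_set/XY | exact: Yw].
    exists X => //; apply/andP; split; first exact: mem_set.
    by apply: sub_all Yw => f /set_mem /YX /mem_set.
  by have [_ _ Xn] := FP _ FX; apply: Xn.
have subL x : L x -> (W `|` [set x]) `<=` L by move=> Lx d [/WL|->].
have Wx x : L x ->
    (forall w, W w -> or_zero W (bracket w x) /\ or_zero W (bracket x w)) -> W x.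
  move=> Lx Wxn; apply: contrapT => nWx.
  apply: (Wmax (W `|` [set x])).
    by split=> [|h]; [exact: subsetUl | apply: nWx; apply: h; right].
  have mono : or_zero W `<=` or_zero (W `|` [set x]).
    by move=> f [Wf|f0]; [left; left | right].
  split; first exact: subL.
    move=> d e [Wd|->] [We|->]; first exact/mono/Wbr.
    - exact/mono/(Wxn d Wd).1.
    - exact/mono/(Wxn e We).2.
    - by right=> y; rewrite /bracket subrr.
  apply: killed_by_words_add => // [d /(subL _ Lx)/LA//|d /(subL _ Lx)/LC//||].
    exact: Lnil.
  by move=> w /Wxn[].
suff WE : L `<=` W.
  move=> w Lw sw x; apply: Wn => //.
  by apply: sub_all Lw => f /set_mem /WE /mem_set.
move=> x0 Lx0; apply: contrapT => nWx0.
have zeroW x : L x -> (forall y, x y = 0) -> W x.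
  move=> Lx x_0; apply: Wx => // w Ww; split; right=> y.
    by rewrite /bracket !x_0 (map0 (LA _ (WL _ Ww))) subrr.
  by rewrite /bracket !x_0 (map0 (LA _ (WL _ Ww))) subrr.
have [||||x [Lx nTx xn]] :=
  exists_normalizing (T := or_zero W) (K := L) _ Wn (LA _ Lx0) _ _ Lx0.
- by move=> d /WL/LA.
- by move=> f f0; right.
- by case=> // x0_0; apply: nWx0; apply: zeroW.
- by move=> w x /WL Lw Lx; split; apply: Lbr.
by apply: nTx; left; apply: Wx.
Qed.

End Engel.

(** * Derivations of a commutative ring *)

Section Derivations.
Variable R : comNzRingType.
Implicit Types (d e l : R -> R) (L S : set (R -> R)).

Definition derivation d :=
  GRing.zmod_morphism d /\ forall a b, d (a * b) = d a * b + a * d b.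

Definition derivations L := forall d, L d -> derivation d.

Definition constants L := [set c | forall d, L d -> d c = 0].

Lemma derivation1 d : derivation d -> d 1 = 0.
Proof.
by move=> [dA dM]; have /eqP := dM 1 1; rewrite !mulr1 mul1r -subr_eq subrr => /eqP.
Qed.

Lemma derivation_comb I (r : seq I) (c : I -> R) (z : I -> R -> R) :
  (forall i, derivation (z i)) ->
  derivation (fun a => \sum_(i <- r) c i * z i a).
Proof.
move=> zD; split=> a b.
  by rewrite -sumrB; apply: eq_bigr => i _; rewrite (zD i).1 mulrBr.
rewrite mulr_suml mulr_sumr -big_split; apply: eq_bigr => i _ /=.
by rewrite (zD i).2; ring.
Qed.

Lemma derivations_additive L : derivations L -> additive_maps L.
Proof. by move=> LD d /LD[]. Qed.

Lemma subring_constants L : derivations L -> subring (constants L).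
Proof.
move=> LD; split=> [d /LD/derivation1//|x y cx cy d Ld|x y cx cy d Ld].
  by rewrite (LD _ Ld).1 (cx d Ld) (cy d Ld) subr0.
by rewrite (LD _ Ld).2 (cx d Ld) (cy d Ld) mul0r mulr0 addr0.
Qed.

Lemma linear_over_constants L : derivations L -> linear_over (constants L) L.
Proof. by move=> LD d Ld c x cL; rewrite (LD _ Ld).2 (cL d Ld) mul0r add0r. Qed.

Lemma derivationX d x n : derivation d -> d (x ^+ n) = x ^+ n.-1 * d x *+ n.
Proof.
move=> dD; elim: n => [|n IH]; first by rewrite expr0 derivation1.
rewrite exprS dD.2 IH; case: n {IH} => [|n]; first by rewrite expr0 mulr0n; ring.
by rewrite -[in RHS]mulr_natr -[in LHS]mulr_natr !exprS /= -[n.+2]addn1 natrD; ring.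
Qed.

Lemma derivation_pchar p d x : (p%:R : R) = 0 -> derivation d -> d (x ^+ p) = 0.
Proof. by move=> p0 dD; rewrite derivationX // -mulr_natr p0 mulr0. Qed.

Lemma subring_nil_at d : derivation d -> subring (nil_at d).
Proof.
move=> dD; have [dA dM] := dD; split.
- by exists 1%N; apply: derivation1.
- by move=> x y; apply: nil_atB.
suff nilM k : forall m n x y, (m + n <= k)%N ->
    iter m d x = 0 -> iter n d y = 0 -> iter k d (x * y) = 0.
  by move=> x y [m xm] [n yn]; exists (m + n)%N; apply: nilM xm yn.
elim: k => [|k IH] [|m] [|n] x y // mn xm yn.
- by rewrite (xm : x = 0) mul0r.
- by rewrite (xm : x = 0) mul0r iter_map0.
- by rewrite (xm : x = 0) mul0r iter_map0.
- by rewrite (yn : y = 0) mulr0 iter_map0.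
rewrite iterSr dM (mapD (iter_additive dA _)).
by rewrite (IH m n.+1) ?(IH m.+1 n) ?addr0 -?iterSr //; lia.
Qed.

(** In characteristic [p] an inverse of [x] is [x ^+ p.-1] times the [p]-th power
    of that inverse, and [p]-th powers are constants. *)
Lemma nil_at_inverse p d x y : (0 < p)%N -> (p%:R : R) = 0 -> derivation d ->
  x * y = 1 -> nil_at d x -> nil_at d y.
Proof.
move=> p_gt0 p0 dD xy nx.
have -> : y = x ^+ p.-1 * y ^+ p.
  by rewrite -[p in RHS](prednK p_gt0) /= exprS mulrCA -exprMn xy expr1n mulr1.
apply: (subringM (subring_nil_at dD)); first exact: (subringX (subring_nil_at dD)).
by exists 1%N; apply: (derivation_pchar _ p0).
Qed.

Lemma derivation_inverse0 d x y : derivation d -> x * y = 1 -> d x = 0 -> d y = 0.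
Proof.
move=> dD xy dx; have := derivation1 dD; rewrite -xy dD.2 dx mul0r add0r => xdy.
by rewrite -[d y]mul1r -xy mulrAC xdy mul0r.
Qed.

Definition generated_over (C G : set R) :=
  forall T, subring T -> C `<=` T -> G `<=` T -> forall x, T x.

(** In characteristic [p] the [p]-th powers are constants, so the monomials in
    the generators with exponents below [p] span the ring over the constants. *)
Lemma dependent_over_pchar (R_domain : GRing.integral_domain_axiom R)
    p m (g : 'I_m -> R) L : (0 < p)%N -> (p%:R : R) = 0 -> derivations L ->
    generated_over (constants L) (range g) ->
  exists n, dependent_over (constants L) n.
Proof.
move=> p_gt0 p0 LD gen; have Csub := subring_constants LD.
set C := constants L in gen Csub *.
pose E := {ffun 'I_m -> 'I_p}.
pose mon (k : E) := \prod_i g i ^+ k i.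
pose spanned := [set x | exists a : E -> R,
  (forall k, C (a k)) /\ x = \sum_k a k * mon k].
have spanD x y : spanned x -> spanned y -> spanned (x + y).
  move=> [a [Ca ->]] [b [Cb ->]]; exists (fun k => a k + b k); split=> [k|].
    exact: (subringD Csub).
  by rewrite -big_split; apply: eq_bigr => k _; rewrite mulrDl.
have spanZ c x : C c -> spanned x -> spanned (c * x).
  move=> Cc [a [Ca ->]]; exists (fun k => c * a k); split=> [k|].
    by apply: (subringM Csub).
  by rewrite mulr_sumr; apply: eq_bigr => k _; rewrite mulrA.
have span_mon k : spanned (mon k).
  exists (fun f => if f == k then 1 else 0); split=> [f|].
    by case: ifP => _; [exact: (subring1 Csub) | exact: (subring0 Csub)].
  rewrite (bigD1 k) //= eqxx mul1r big1 ?addr0 // => f /negPf->.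
  by rewrite mul0r.
have span0 : spanned 0.
  rewrite -(mul0r (mon [ffun=> Ordinal p_gt0])).
  by apply: spanZ (span_mon _); exact: (subring0 Csub).
have span_sum (F : E -> R) : (forall k, spanned (F k)) -> spanned (\sum_k F k).
  by move=> FS; elim/big_ind: _.
have span_gen i x : spanned x -> spanned (g i * x).
  move=> [a [Ca ->]]; rewrite mulr_sumr; apply: span_sum => k.
  rewrite mulrCA; apply: (spanZ) => //.
  have gmon (f : E) : (forall j, j != i -> f j = k j) ->
      mon f = g i ^+ f i * \prod_(j | j != i) g j ^+ k j.
    by move=> fe; rewrite /mon (bigD1 i) //=; congr (_ * _); apply: eq_bigr => j /fe->.
  have [ep|pe] := ltnP (k i).+1 p.
    have := span_mon [ffun j => if j == i then Ordinal ep else k j].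
    rewrite gmon ?(gmon k) ?ffunE ?eqxx //= ?exprS ?mulrA // => j /negPf ji.
    by rewrite ffunE ji.
  have := span_mon [ffun j => if j == i then Ordinal p_gt0 else k j].
  rewrite (gmon k) // gmon ?ffunE ?eqxx //= => [smon|j /negPf ji]; last by rewrite ffunE ji.
  move: smon; rewrite expr0 mul1r mulrA -exprS => smon.
  have -> : (k i).+1 = p by apply/eqP; rewrite eqn_leq pe ltn_ord.
  by apply: (spanZ _ _ _ smon) => d Ld; apply: (derivation_pchar _ p0) (LD _ Ld).
pose T := [set y | forall x, spanned x -> spanned (y * x)].
have Tall : forall y, T y.
  apply: gen => [|c Cc x|_ [i _ <-]]; [|exact: spanZ|exact: span_gen].
  split=> [x|x y Tx Ty z Sz|x y Tx Ty z Sz]; first by rewrite mul1r.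
    rewrite mulrBl; apply: spanD; first exact: Tx.
    rewrite -mulN1r; apply: spanZ; last exact: Ty.
    exact: (subringN Csub (subring1 Csub)).
  by rewrite -mulrA; apply/Tx/Ty.
have span1 : spanned 1.
  have := span_mon [ffun=> Ordinal p_gt0].
  by rewrite /mon big1 // => i _; rewrite ffunE expr0.
exists #|{: E}| => u; apply: (dependent_spanned R_domain Csub
  (v := fun i => mon (enum_val i))) => i.
have [a [Ca ua]] : spanned (u i) by rewrite -[u i]mulr1; apply: Tall.
exists (fun j => a (enum_val j)); split=> //.
by rewrite ua (reindex (@enum_val E predT)) //; apply/onW_bij/enum_val_bij.
Qed.

End Derivations.

(** * Flags in nilpotent Lie algebras of derivations *)

Section DerivedBrackets.
Variable V : zmodType.

Fixpoint derived_brackets (L : set (V -> V)) (k : nat) : set (V -> V) :=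
  if k is k'.+1 then derived_brackets [set bracket d e | d in L & e in L] k' else L.

Lemma derived_bracketsSr L k : derived_brackets L k.+1 =
  [set bracket d e | d in derived_brackets L k & e in derived_brackets L k].
Proof. by elim: k L => [|k IH] L //; rewrite -IH. Qed.

End DerivedBrackets.

Section Flags.
Variables (R : comNzRingType) (R_domain : GRing.integral_domain_axiom R).
Implicit Types (d e z l : R -> R) (zs : seq (R -> R)) (L S : set (R -> R)).

(** The maps in the span of [zs] over the field of fractions of [R]. *)
Fixpoint frac_span zs d : Prop :=
  if zs is z :: zs' then
    exists c u, c != 0 /\ frac_span zs' (fun a => c * d a - u * z a)
  else forall a, d a = 0.

Lemma frac_span_comb zs d e x y : frac_span zs d -> frac_span zs e ->
  frac_span zs (fun a => x * d a + y * e a).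
Proof.
elim: zs d e x y => [|z zs IH] d e x y /=.
  by move=> d0 e0 a; rewrite d0 e0 !mulr0 addr0.
move=> [c [u [c0 dz]]] [c' [u' [c'0 ez]]].
exists (c * c'), (c' * x * u + c * y * u'); split; first exact: domain_mulf_neq0.
have := IH _ _ (x * c') (y * c) dz ez; congr frac_span.
by apply/funext => a; ring.
Qed.

Lemma frac_span0 zs d : (forall a, d a = 0) -> frac_span zs d.
Proof.
elim: zs d => //= z zs IH d d0; exists 1, 0; split; first exact: oner_neq0.
by apply: IH => a; rewrite d0 mulr0 mul0r subrr.
Qed.

Lemma frac_spanZ zs d x : frac_span zs d -> frac_span zs (fun a => x * d a).
Proof.
move=> dz; have := frac_span_comb x 0 dz dz; congr frac_span.
by apply/funext => a; ring.
Qed.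

Lemma frac_span_pure zs d x : x != 0 -> frac_span zs (fun a => x * d a) ->
  frac_span zs d.
Proof.
case: zs => [|z zs] /= x0; first by move=> xd a; apply: domain_eq0 (xd a).
move=> [c [u [c0 h]]]; exists (c * x), u; split; first exact: domain_mulf_neq0.
by move: h; congr frac_span; apply/funext => a; rewrite mulrA.
Qed.

Lemma frac_span_cons z zs d : frac_span zs d -> frac_span (z :: zs) d.
Proof.
move=> dz; exists 1, 0; split; first exact: oner_neq0.
by move: dz; congr frac_span; apply/funext => a; rewrite mul1r mul0r subr0.
Qed.

Lemma frac_span_head z zs : frac_span (z :: zs) z.
Proof.
exists 1, 1; split; first exact: oner_neq0.
by apply: frac_span0 => a; rewrite subrr.
Qed.

(** The list grows at its head: each [z] is central modulo the span of its tail. *)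
Fixpoint flag L zs : Prop :=
  if zs is z :: zs' then
    [/\ flag L zs', L z, ~ frac_span zs' z
      & forall l, L l -> frac_span zs' (bracket l z)]
  else True.

(** Up to the span of [zs], the element [e] is [v / c] times [z], and bracketing
    with [l] differentiates this coefficient. *)
Lemma frac_span_bracket_coef zs z e c v l : derivation l ->
    frac_span zs (bracket l z) ->
    frac_span zs (fun a => c * e a - v * z a) ->
    frac_span zs (bracket l (fun a => c * e a - v * z a)) ->
  frac_span zs
    (fun a => c * c * bracket l e a - (c * l v - v * l c) * z a).
Proof.
move=> [lA lM] lz ez lez.
have := frac_span_comb 1 1 (frac_span_comb c (c * v) lez lz)
                       (frac_spanZ (- l c) ez).
congr frac_span; apply/funext => a; rewrite /bracket lA !lM; ring.
Qed.

Lemma frac_span_bracket L zs d l : derivations L -> flag L zs -> L l ->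
  frac_span zs d -> frac_span zs (bracket l d).
Proof.
move=> LD + Ll; elim: zs d => [|z zs IH] d /=.
  by move=> _ d0 a; rewrite /bracket !d0 (map0 (LD _ Ll).1) subrr.
move=> [Fzs Lz nz Lbr] [c [u [c0 dz]]].
exists (c * c), (c * l u - u * l c); split; first exact: domain_mulf_neq0.
by apply: frac_span_bracket_coef => //; [exact: LD | exact: Lbr | exact: IH].
Qed.

Lemma frac_span_coef zs d c v : (forall z, List.In z zs -> c * z v = v * z c) ->
  frac_span zs d -> c * d v = v * d c.
Proof.
elim: zs d => [|z zs IH] d /= zc; first by move=> d0; rewrite !d0 !mulr0.
move=> [b [u [b0 h]]].
have := IH _ (fun z' hz' => zc z' (or_intror hz')) h.
have /= zv := zc z (or_introl erefl).
move=> /eqP; rewrite -subr_eq0 => /eqP E.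
apply/eqP; rewrite -subr_eq0; apply/eqP; apply: (domain_eq0 R_domain b0).
rewrite -[RHS]E.
transitivity (b * (c * d v - v * d c) - u * (c * z v - v * z c)); last by ring.
by rewrite zv; ring.
Qed.

Lemma flag_in L zs z : flag L zs -> List.In z zs ->
  L z /\ forall l, L l -> frac_span zs (bracket l z).
Proof.
elim: zs => //= y zs IH [Fzs Ly _ yL] [<-|/(IH Fzs)[Lz zL]]; split=> // l Ll.
  exact/frac_span_cons/yL.
exact/frac_span_cons/zL.
Qed.

(** The coefficient of [z] in [e] is a constant of every member of the flag,
    because these send [e] into the span of [zs]; it is therefore a constant of
    every combination [d] of members of the flag. *)
Lemma flag_abelian_step L z zs d e : derivations L -> flag L (z :: zs) ->
    L d -> L e -> frac_span (z :: zs) d -> frac_span (z :: zs) e ->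
  frac_span zs (bracket d e).
Proof.
move=> LD Fz Ld Le dz [c [v [c0 ez]]].
have [Fzs Lz nz zL] := Fz.
have coef l : L l -> frac_span zs
    (fun a => c * c * bracket l e a - (c * l v - v * l c) * z a).
  move=> Ll; apply: frac_span_bracket_coef => //; [exact: LD|exact: zL|].
  exact: (frac_span_bracket LD).
have const y : List.In y (z :: zs) -> c * y v = v * y c.
  move=> iny; have Ly : L y by have [] := flag_in Fz iny.
  have ye : frac_span zs (bracket y e).
    have ey : frac_span zs (bracket e y).
      case: iny => [<-|iny]; first exact: zL.
      by apply: (flag_in Fzs iny).2.
    have := frac_spanZ (-1) ey; congr frac_span.
    by apply/funext => a; rewrite /bracket; ring.
  apply/eqP; rewrite -subr_eq0; apply/negPn/negP => k0; apply: nz.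
  apply: (frac_span_pure k0).
  have := frac_span_comb (c * c) (-1) ye (coef _ Ly); congr frac_span.
  by apply/funext => a; ring.
have dc := frac_span_coef const dz.
have := coef _ Ld; rewrite dc subrr => h.
apply: (frac_span_pure (domain_mulf_neq0 R_domain c0 c0)).
by move: h; congr frac_span; apply/funext => a; rewrite mul0r subr0.
Qed.

Lemma flag_derived_brackets L zs S k : derivations L -> bracket_closed L ->
    flag L zs -> S `<=` L -> (forall d, S d -> frac_span zs d) ->
    (size zs <= k)%N ->
  forall d, derived_brackets S k d -> forall a, d a = 0.
Proof.
move=> LD Lbr; elim: zs k S => [|z zs IH] k S Fz SL Sz sk.
  elim: k S SL Sz {sk} => [|k IH] S SL Sz d; first exact: Sz.
  apply: IH => {d} [_ [d Sd] [e Se <-]|_ [d Sd] [e Se <-] a].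
    by apply: Lbr; apply: SL.
  by rewrite /bracket !(Sz e Se) (map0 (LD _ (SL _ Sd)).1) subrr.
case: k sk => // k sk d; have [Fzs _ _ _] := Fz.
apply: (IH k) => // {d} _ [d Sd] [e Se <-]; first by apply: Lbr; apply: SL.
by apply: (flag_abelian_step LD Fz); [exact: SL|exact: SL|exact: Sz|exact: Sz].
Qed.

Lemma flag_extend L zs n : derivations L -> bracket_closed L ->
    killed_by_words L n -> flag L zs -> ~ (forall d, L d -> frac_span zs d) ->
  exists z, flag L (z :: zs).
Proof.
move=> LD Lbr Ln Fzs /existsNP[x0 /not_implyP[Lx0 nx0]].
have [|z [Lz nz zL]] := exists_normalizing (derivations_additive LD) Ln
  (derivations_additive LD Lx0) (@frac_span0 zs) nx0 Lx0.
  by move=> w x Lw Lx; split; apply: Lbr.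
by exists z; split=> // l /zL[].
Qed.

Lemma frac_span_sum zs (c : nat -> R) :
  frac_span zs (fun a => \sum_(i < size zs) c i * nth id zs i a).
Proof.
elim: zs c => [|z zs IH] c; first by move=> a; rewrite big_ord0.
have := frac_span_comb (c 0%N) 1 (frac_span_head z zs)
          (frac_span_cons z (IH (fun i => c i.+1))).
by congr frac_span; apply/funext => a; rewrite mul1r [in RHS]big_ord_recl.
Qed.

Lemma flag_free L zs (c : nat -> R) : flag L zs ->
    (forall a, \sum_(i < size zs) c i * nth id zs i a = 0) ->
  forall i, (i < size zs)%N -> c i = 0.
Proof.
elim: zs c => [|z zs IH] c //= [Fzs Lz nz _] sum0.
have comb : frac_span zs (fun a => \sum_(i < size zs) c i.+1 * nth id zs i a).
  exact: (frac_span_sum zs (fun i => c i.+1)).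
have c0 : c 0%N = 0.
  apply/eqP/negPn/negP => c0; apply: nz; apply: (frac_span_pure c0).
  have := frac_spanZ (-1) comb; congr frac_span; apply/funext => a.
  by have /eqP := sum0 a; rewrite big_ord_recl addr_eq0 => /eqP->; rewrite mulN1r.
case=> [|i] // si; apply: (IH (fun i => c i.+1)) => // a.
by rewrite -[RHS](sum0 a) big_ord_recl /= c0 mul0r add0r.
Qed.

(** A derivation that kills the constants is determined by its values at the
    [m] generators, so a flag has at most [m] members. *)
Theorem derived_brackets_eq0 L n m (g : 'I_m -> R) :
    derivations L -> bracket_closed L -> killed_by_words L n ->
    generated_over (constants L) (range g) ->
  forall d, derived_brackets L m d -> forall a, d a = 0.
Proof.
move=> LD Lbr Ln gen.
have small zs : flag L zs -> size zs != m.+1.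
  move=> Fzs; apply/eqP => szs.
  have setTsub : subring [set: R] by split.
  have [c [_ [i ci] cx]] := dependent_rows R_domain setTsub
    (fun (i : 'I_m.+1) j => I : [set: R] (nth id zs i (g j))).
  case/negP: ci; apply/eqP; rewrite -[i]inord_val.
  apply: (flag_free (c := fun i => c (inord i)) Fzs); last by rewrite szs.
  have zD (k : 'I_m.+1) : derivation (nth id zs k).
    have : (k < size zs)%N by rewrite szs.
    elim: zs Fzs {szs cx} (k : nat) => [|z zs IH] //= [Fzs Lz _ _] [|k'] //=.
      by move=> _; apply: LD.
    exact: IH.
  pose D a := \sum_(k < m.+1) c k * nth id zs k a.
  have DD : derivation D by apply: derivation_comb.
  move=> a; rewrite szs; transitivity (D a).
    by apply: eq_bigr => k _; rewrite inord_val.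
  move: a; apply: gen => [|x Cx|_ [j _ <-]]; last exact: cx.
    have := subring_constants (L := [set D]); rewrite /constants /subring /=.
    case=> [d ->//|D1 DB DM].
    split=> [|x y Dx Dy|x y Dx Dy].
    - exact: D1.
    - by apply: DB => [d ->|d ->|//].
    - by apply: DM => [d ->|d ->|//].
  rewrite /D big1 // => k _; rewrite Cx ?mulr0 //.
  have : (k < size zs)%N by rewrite szs.
  elim: zs Fzs {szs cx zD D DD} (k : nat) => [|z zs IH] //= [Fzs Lz _ _] [|k'] //=.
  exact: IH.
have [zs [Fzs szs [szm|Lzs]]] : exists zs, [/\ flag L zs, (size zs <= m.+1)%N
    & size zs = m.+1 \/ forall d, L d -> frac_span zs d].
  elim: (m.+1) => [|k [zs [Fzs szs]]]; first by exists [::]; split=> //; left.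
  case=> [szk|Lzs]; last by exists zs; split; [|exact: leqW|right].
  have [Lzs|/(flag_extend LD Lbr Ln Fzs)[z Fz]] :=
      pselect (forall d, L d -> frac_span zs d).
    by exists zs; split; [|exact: leqW|right].
  by exists (z :: zs); split; rewrite /= ?szk //; left.
  by have := small _ Fzs; rewrite szm eqxx.
apply: (flag_derived_brackets LD Lbr Fzs) => //.
by rewrite -ltnS ltn_neqAle small.
Qed.

End Flags.

(** * Reduction of a domain of characteristic zero modulo almost all primes *)

Lemma frac_numden (R : idomainType) (x : {fraction R}) :
  exists n d, d != 0 /\ FracField.tofrac d * x = FracField.tofrac n.
Proof.
exists (\n_(repr x)), (\d_(repr x)); split; first exact: denom_ratioP.
rewrite -[X in _ * X]reprK; unlock FracField.tofrac; rewrite -[LHS]FracField.pi_mul.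
apply/eqmodP; rewrite /= FracField.equivfE /FracField.mulf /=.
rewrite !numden_Ratio ?(oner_neq0, mul1r, mulr1, mulf_neq0, denom_ratioP) //.
Qed.

Lemma irreducible_factor (K : fieldType) (p : {poly K}) : (1 < size p)%N ->
  exists2 g, irreducible_poly g & g %| p.
Proof.
elim: {p}(size p) {-2}p (leqnn (size p)) => [|n IH] p; first by case: (size p).
move=> sp p1; have [irr|nirr] := pselect (irreducible_poly p); first by exists p.
have [q [sq qp nqp]] : exists q : {poly K}, [/\ size q != 1%N, q %| p & ~~ (q %= p)].
  apply: contrapT => nq; apply: nirr; split=> // q sq qp.
  by apply/negPn/negP => nqp; apply: nq; exists q.
have p0 : p != 0 by rewrite -size_poly_gt0 (ltn_trans _ p1).
have q0 : q != 0 by apply: contraNneq p0 => q0; move: qp; rewrite q0 dvd0p.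
have sqp : (size q < size p)%N.
  rewrite ltn_neqAle dvdp_leq // andbT; apply: contra nqp.
  by rewrite dvdp_size_eqp.
have q1 : (1 < size q)%N by rewrite ltn_neqAle eq_sym sq size_poly_gt0.
have [|g gi gq] := IH q _ q1; first by rewrite -ltnS (leq_trans sqp).
by exists g => //; apply: dvdp_trans gq qp.
Qed.

Lemma map_poly_cons (R S : nzRingType) (f : {rmorphism R -> S}) (q : {poly R}) c :
  map_poly f (q * 'X + c%:P) = map_poly f q * 'X + (f c)%:P.
Proof. by rewrite rmorphD rmorphM /= map_polyX map_polyC. Qed.

Section EvalPoly.
Variables (R : nzRingType) (A : comNzRingType).
Variables (psi : {rmorphism R -> A}) (y : A).

Definition eval_poly : {poly R} -> A :=
  horner_morph (fun x => mulrC y (psi x) : GRing.comm y (psi x)).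
HB.instance Definition _ := GRing.RMorphism.on eval_poly.

Lemma eval_polyE q : eval_poly q = (map_poly psi q).[y]. Proof. by []. Qed.
Lemma eval_polyC c : eval_poly c%:P = psi c.
Proof. by rewrite eval_polyE map_polyC hornerC. Qed.
Lemma eval_polyX : eval_poly 'X = y.
Proof. by rewrite eval_polyE map_polyX hornerX. Qed.
Lemma eval_polyZ c q : eval_poly (c *: q) = psi c * eval_poly q.
Proof. by rewrite -mul_polyC rmorphM /= eval_polyC. Qed.
End EvalPoly.

Section Reduction.
Variable A : comNzRingType.

(** Let [B] be the image of [psi]. By the second condition [phi] factors through a map
    from [B] to [K], whose kernel [P] is a prime ideal that contains [p]. The third says
    that [P] and [p B] agree after localization at [P], the fourth that [K] is the field
    of fractions of [B / P]. The third condition is the reason why [P] is stable under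
    all derivations of [B]. *)
Definition reduction (R : idomainType) (psi : {rmorphism R -> A}) (p : nat)
    (K : fieldType) (phi : {rmorphism R -> K}) : Prop :=
  [/\ (p%:R : K) = 0, forall q, psi q = 0 -> phi q = 0,
      forall q, phi q = 0 -> exists s r, phi s != 0 /\ psi (s * q) = p%:R * psi r
    & forall x, exists a b, phi b != 0 /\ phi b * x = phi a].

Definition has_reductions (R : idomainType) (psi : {rmorphism R -> A}) : Prop :=
  forall a, psi a != 0 -> exists2 N, (0 < N)%N & forall p, prime p -> ~~ (p %| N)%N ->
    exists (K : fieldType) (phi : {rmorphism R -> K}),
      reduction psi p phi /\ phi a != 0.

Lemma has_reductions_int : (forall n, (n.+1%:R : A) != 0) ->
  has_reductions (intr : {rmorphism int -> A}).
Proof.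
move=> char0 a.
have int0 (z : int) : (z%:~R : A) = 0 -> z = 0.
  case: (intP z) => // n; first by move/eqP; rewrite (negPf (char0 n)).
  by move/eqP; rewrite rmorphN oppr_eq0 (negPf (char0 n)).
move=> a0; exists `|a|%N; first by rewrite absz_gt0; apply: contraNneq a0 => ->.
move=> p pp pa; exists 'F_p, (intr : {rmorphism int -> 'F_p}).
have pF : (p%:R : 'F_p) = 0 := pcharf0 (pchar_Fp pp).
have dvdF (z : int) : ((z%:~R : 'F_p) == 0) = (p %| `|z|)%N.
  by rewrite -(dvdz_pcharf (pchar_Fp pp)).
split; last by rewrite dvdF.
split=> // [q /int0->//|q /eqP|x].
  rewrite dvdF => /dvdnP[k qk]; exists 1, (sgz q * k%:Z); split.
    exact: oner_neq0.
  rewrite mul1r; have {1}-> : q = p%:Z * (sgz q * k%:Z).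
    by rewrite {1}[q]intEsg qk PoszM; ring.
  by rewrite rmorphM.
exists (nat_of_ord x)%:Z, 1; split; first exact: oner_neq0.
by rewrite rmorph1 mul1r -[LHS]natr_Zp.
Qed.

Section Adjoin.
Variables (R : idomainType) (psi : {rmorphism R -> A}) (p : nat).
Variables (K : fieldType) (phi : {rmorphism R -> K}).
Hypothesis red : reduction psi p phi.

Lemma clear_denominators (h : {poly K}) :
  exists c H, phi c != 0 /\ map_poly phi H = phi c *: h.
Proof.
have [_ _ _ frac] := red; elim/poly_ind: h => [|h x [c [H [c0 Hh]]]].
  by exists 1, 0; rewrite rmorph1 oner_neq0 rmorph0 scaler0.
have [a [b [b0 bx]]] := frac x.
exists (c * b), ((b *: H) * 'X + (c * a)%:P); split; first by rewrite rmorphM mulf_neq0.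
rewrite map_poly_cons map_polyZ Hh !rmorphM /= -bx.
by rewrite -!mul_polyC !polyCM; ring.
Qed.

Lemma divide_coefficients (q : {poly R}) : map_poly phi q = 0 ->
  exists s r, phi s != 0 /\ map_poly psi (s *: q) = p%:R *: map_poly psi r.
Proof.
have [_ _ divp _] := red; elim/poly_ind: q => [_|q c IH].
  by exists 1, 0; rewrite rmorph1 oner_neq0 scaler0 !rmorph0 scaler0.
rewrite map_poly_cons => /polyP qc.
have c0 : phi c = 0 by have := qc 0%N; rewrite coefD coefMX coefC coef0 add0r.
have /IH[s [r [s0 sr]]] : map_poly phi q = 0.
  by apply/polyP => i; have := qc i.+1; rewrite coefD coefMX coefC /= addr0 !coef0.
have [t [u [t0 tu]]] := divp c c0.
exists (s * t), ((t *: r) * 'X + (s * u)%:P); split; first by rewrite rmorphM mulf_neq0.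
rewrite map_polyZ !map_poly_cons map_polyZ !rmorphM /=.
rewrite map_polyZ in sr.
rewrite -!mul_polyC mulrDr !polyCM !mulrA.
move: (congr1 (fun f => (psi t)%:P * f * 'X) sr) (congr1 (fun x => (psi s)%:P * x%:P) tu).
rewrite -!mul_polyC rmorphM /= !polyCM => e1 e2.
transitivity ((psi t)%:P * ((psi s)%:P * map_poly psi q) * 'X
  + (psi s)%:P * ((psi t)%:P * (psi c)%:P)); first by ring.
by rewrite e1 e2; ring.
Qed.

Lemma map_poly_reduction (q : {poly R}) : map_poly psi q = 0 -> map_poly phi q = 0.
Proof.
have [_ psi0 _ _] := red; move=> /polyP q0; apply/polyP => i; rewrite coef_map coef0.
by apply: psi0; rewrite -coef_map q0 coef0.
Qed.

Definition transcendental_reduction : {poly R} -> {fraction {poly K}} :=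
  @FracField.tofrac _ \o map_poly phi.
HB.instance Definition _ := GRing.RMorphism.on transcendental_reduction.

Lemma transcendental_reductionE q :
  transcendental_reduction q = FracField.tofrac (map_poly phi q).
Proof. by []. Qed.

(** The prime ideal [P [y]] has [K (y)] as field of fractions of its quotient. *)
Lemma reduction_transcendental (y : A) :
    (forall q, eval_poly psi y q = 0 -> map_poly psi q = 0) ->
  reduction (eval_poly psi y) p transcendental_reduction.
Proof.
have [p0 psi0 divp frac] := red; move=> tr.
have tq q : transcendental_reduction q = 0 -> map_poly phi q = 0.
  by move/eqP; rewrite /= !transcendental_reductionE tofrac_eq0 => /eqP.
split=> [|q /tr/map_poly_reduction q0|q /tq/divide_coefficients[s [r [s0 sr]]]|x].
- by rewrite -(rmorph_nat (@FracField.tofrac _)) -(rmorph_nat (@polyC K)) p0 !rmorph0.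
- by rewrite /= !transcendental_reductionE q0 rmorph0.
- exists s%:P, r; split.
    by rewrite /= !transcendental_reductionE tofrac_eq0 map_polyC polyC_eq0.
  by rewrite mul_polyC /= !eval_polyE sr hornerZ.
- have [n [d [d0 dx]]] := frac_numden x.
  have [c [D [c0 Dd]]] := clear_denominators d.
  have [e [N [e0 Nn]]] := clear_denominators n.
  exists (c *: N), (e *: D); rewrite /= !transcendental_reductionE; split.
    by rewrite tofrac_eq0 map_polyZ Dd !scaler_eq0 !negb_or e0 c0.
  rewrite !map_polyZ Dd Nn -!mul_polyC !rmorphM /= -dx; ring.
Qed.

End Adjoin.

(** [f] plays the role of the minimal polynomial of [y] over the image of [psi]. *)
Definition minimal_annihilator (R : idomainType) (psi : {rmorphism R -> A}) (y : A)
    (f : {poly R}) : Prop :=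
  [/\ eval_poly psi y f = 0, psi (lead_coef f) != 0
    & forall u : {poly R}, (size u < size f)%N -> eval_poly psi y u = 0 ->
      map_poly psi u = 0].

Lemma exists_minimal_annihilator (R : idomainType) (psi : {rmorphism R -> A}) (y : A)
    (q : {poly R}) : eval_poly psi y q = 0 -> map_poly psi q <> 0 ->
  exists f, minimal_annihilator psi y f.
Proof.
move=> q0 nq.
have : exists n, exists f : {poly R},
    [/\ (size f <= n)%N, eval_poly psi y f = 0 & map_poly psi f <> 0].
  by exists (size q), q.
case=> n; elim: n => [|n IH] [f [sf f0 nf]].
  by case: nf; move: sf; rewrite leqn0 size_poly_eq0 => /eqP->; rewrite rmorph0.
have [[g [sg g0 ng]]|nog] := pselect (exists g : {poly R},
    [/\ (size g <= n)%N, eval_poly psi y g = 0 & map_poly psi g <> 0]).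
  by apply: IH; exists g.
have sfn : size f = n.+1.
  apply/eqP; rewrite eqn_leq sf ltnNge; apply/negP => fn.
  by apply: nog; exists f.
exists f; split=> // [|u su u0].
  apply/eqP => l0; apply: nog; exists (take_poly n f).
  have mapt : map_poly psi (take_poly n f) = map_poly psi f.
    apply/polyP => i; rewrite !coef_map coef_take_poly /=; case: ltnP => // ni.
    rewrite rmorph0; have [->|nin] := eqVneq i n.
      by rewrite -[LHS]l0 lead_coefE sfn.
    by rewrite nth_default ?rmorph0 // sfn ltn_neqAle eq_sym nin.
  by split; rewrite ?size_take_poly // ?eval_polyE mapt.
apply: contrapT => nu; apply: nog; exists u; split=> //.
by rewrite -ltnS -sfn.
Qed.

Section Algebraic.
Hypothesis A_domain : GRing.integral_domain_axiom A.
Hypothesis char0 : forall n, (n.+1%:R : A) != 0.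
Variables (R : idomainType) (psi : {rmorphism R -> A}) (y : A) (f : {poly R}).
Hypothesis fmin : minimal_annihilator psi y f.

Local Notation l := (lead_coef f).

Lemma psi_lead_neq0 k : psi (l ^+ k) != 0.
Proof.
have [_ l0 _] := fmin; elim: k => [|k IH]; first by rewrite rmorph1 oner_neq0.
by rewrite exprS rmorphM; apply: domain_mulf_neq0.
Qed.

Lemma annihilator_size : (1 < size f)%N.
Proof.
have [f0 l0 _] := fmin; rewrite ltnNge; apply/negP => /size1_polyC fC.
by move: f0 l0; rewrite fC eval_polyC lead_coefC => ->; rewrite eqxx.
Qed.

Lemma annihilator_neq0 : f != 0.
Proof. by rewrite -size_poly_gt0 (ltn_trans _ annihilator_size). Qed.

Lemma pseudo_division (u : {poly R}) : exists k v r,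
  l ^+ k *: u = v * f + r /\ (size r < size f)%N.
Proof.
exists (scalp u f), (u %/ f), (u %% f); rewrite Pdiv.Idomain.divp_eq; split=> //.
by rewrite Pdiv.Idomain.ltn_modpN0 // annihilator_neq0.
Qed.

Lemma eval_deriv_neq0 : eval_poly psi y f^`() != 0.
Proof.
have [_ l0 min] := fmin; have s1 := annihilator_size.
apply/eqP => /min; rewrite lt_size_deriv ?annihilator_neq0 // => /(_ isT)/polyP.
move/(_ (size f).-2); rewrite coef_map coef_deriv coef0 /=.
have -> : (size f).-2.+1 = (size f).-1 by case: (size f) s1 => [|[]].
rewrite -lead_coefE rmorphMn /= -mulr_natr; apply/eqP.
apply: domain_mulf_neq0 => //; case: (size f) s1 => [|[|n]] // _; exact: char0.
Qed.

(** A nonzero element algebraic over the image of [psi] divides a nonzero element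
    of it: the powers of the element are linearly dependent, and cancelling the
    element from such a relation leaves a nonzero constant term. *)
Lemma minimal_multiple (e : {poly R}) : eval_poly psi y e != 0 ->
  exists u r, psi r != 0 /\ eval_poly psi y e * eval_poly psi y u = psi r.
Proof.
move=> e0; set x := eval_poly psi y e in e0 *.
have [f0 _ _] := fmin.
have subr : subring (range psi).
  split=> [|_ _ [a _ <-] [b _ <-]|_ _ [a _ <-] [b _ <-]].
  - by exists 1; rewrite ?rmorph1.
  - by exists (a - b); rewrite ?rmorphB.
  - by exists (a * b); rewrite ?rmorphM.
pose n := (size f).-1.
have /choice[k kP] : forall i, exists k, exists2 r : {poly R}, (size r <= n)%N
    & psi (l ^+ k) * x ^+ i = eval_poly psi y r.
  move=> i; have [k [v [r [kvr sr]]]] := pseudo_division (e ^+ i).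
  exists k, r; first by rewrite -ltnS prednK // (leq_trans _ sr).
  rewrite -[RHS]add0r -[X in X + _](mulr0 (eval_poly psi y v)) -f0 -rmorphM -rmorphD.
  by rewrite -kvr /= eval_polyZ; congr (_ * _); rewrite [RHS]rmorphXn.
have [|c [Cc [i0 ci0] cx]] := dependent_spanned A_domain subr
    (v := fun j : 'I_n => y ^+ j) (u := fun i : 'I_n.+1 => psi (l ^+ k i) * x ^+ i).
  move=> i; have [r sr ->] := kP i; exists (fun j => psi r`_j).
  split=> [j|]; first by exists r`_j.
  rewrite eval_polyE (horner_coef_wide _ (leq_trans (size_poly _ _) sr)).
  by apply: eq_bigr => j _; rewrite coef_map.
have /choice[b bc] : forall i, exists b, psi b = c i.
  by move=> i; have [b _ <-] := Cc i; exists b.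
pose G := \poly_(i < n.+1) (b (inord i) * l ^+ k i).
have Gx : (map_poly psi G).[x] = 0.
  rewrite (horner_coef_wide (n := n.+1)) -?[RHS]cx; last first.
    by rewrite (leq_trans (size_poly _ _)) // size_poly.
  apply: eq_bigr => i _.
  by rewrite coef_map coef_poly ltn_ord inord_val /= rmorphM bc mulrA.
have nG : map_poly psi G <> 0.
  move/polyP/(_ i0); rewrite coef_map coef_poly ltn_ord inord_val coef0 /= rmorphM bc.
  by apply/eqP/domain_mulf_neq0 => //; exact: psi_lead_neq0.
elim/poly_ind: {f0 cx}G Gx nG => [|G a IH]; first by rewrite rmorph0.
rewrite map_poly_cons hornerMXaddC.
have [a0|a0] := eqVneq (psi a) 0; last first.
  move=> /eqP; rewrite addr_eq0 => /eqP Ga _.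
  exists (- (G \Po e)), (- - a); split; first by rewrite opprK.
  rewrite !rmorphN /= eval_polyE map_comp_poly horner_comp.
  by rewrite -[(map_poly psi e).[y]]/x mulrN mulrC Ga.
rewrite a0 addr0 => Gx nG; apply: IH; last by move=> G0; apply: nG; rewrite G0 mul0r addr0.
by apply: (domain_eq0 A_domain e0); rewrite mulrC.
Qed.

Section AdjoinRoot.
Variables (p : nat) (K : fieldType) (phi : {rmorphism R -> K}).
Hypothesis red : reduction psi p phi.
Hypothesis phil : phi l != 0.
Variables (g : {poly K}) (L : fieldExtType K) (z : L).
Hypothesis g_irr : irreducible_poly g.
Hypothesis gf : g %| map_poly phi f.
Hypothesis gz : root (map_poly (in_alg L) g) z.
Hypothesis Lz : <<1; z>>%VS = fullv.

Definition algebraic_reduction : {poly R} -> L :=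
  eval_poly (in_alg L : {rmorphism K -> L}) z \o map_poly phi.
HB.instance Definition _ := GRing.RMorphism.on algebraic_reduction.

Lemma algebraic_reductionE q :
  algebraic_reduction q = (map_poly (in_alg L) (map_poly phi q)).[z].
Proof. by []. Qed.

Lemma algebraic_reduction_eval0 q : eval_poly psi y q = 0 -> algebraic_reduction q = 0.
Proof.
have [f0 _ min] := fmin => q0; have [k [v [r [kvr sr]]]] := pseudo_division q.
have r0 : map_poly psi r = 0.
  apply: min => //; have := congr1 (eval_poly psi y) kvr.
  by rewrite eval_polyZ q0 mulr0 rmorphD rmorphM /= f0 mulr0 add0r.
have := congr1 algebraic_reduction kvr.
rewrite rmorphD rmorphM /= !algebraic_reductionE (map_poly_reduction red r0).
rewrite rmorph0 horner0 addr0.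
have -> : (map_poly (in_alg L) (map_poly phi f)).[z] = 0.
  by rewrite -(divpK gf) rmorphM hornerM (eqP gz) mulr0.
rewrite mulr0 !map_polyZ hornerZ => /eqP; rewrite mulf_eq0 fmorph_eq0 rmorphXn.
by rewrite expf_eq0 (negPf phil) andbF => /eqP.
Qed.

Hypothesis f'z : algebraic_reduction f^`() != 0.

(** Separability makes [z] a simple root of [f] modulo [p], so the kernel of the
    reduction is cut out by [p] and [f] up to a multiplier not vanishing at [z]. *)
Lemma reduction_algebraic :
  reduction (eval_poly psi y) p algebraic_reduction.
Proof.
have [p0 psi0 divp frac] := red; have [f0 _ _] := fmin.
split=> [|q|q|x].
- by rewrite -(rmorph_nat (in_alg L)) p0 rmorph0.
- exact: algebraic_reduction_eval0.
- rewrite /= algebraic_reductionE => qz.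
  have gq : g %| map_poly phi q.
    apply/negPn/negP; rewrite -(irreducible_poly_coprime _ g_irr).
    by rewrite -(coprimep_map (in_alg L)) => /coprimep_root/(_ gz); rewrite qz eqxx.
  pose h := map_poly phi f %/ g; pose k := map_poly phi q %/ g.
  have fgh : map_poly phi f = h * g by rewrite divpK.
  have qgk : map_poly phi q = k * g by rewrite divpK.
  have hz : (map_poly (in_alg L) h).[z] != 0.
    apply: contraNneq f'z => hz; rewrite algebraic_reductionE -deriv_map fgh.
    by rewrite derivM rmorphD !rmorphM hornerD !hornerM (eqP gz) hz mulr0 mul0r addr0.
  have [c [H [c0 Hh]]] := clear_denominators red h.
  have [b [M [b0 Mk]]] := clear_denominators red k.
  have mod0 : map_poly phi ((b *: H) * q - (c *: M) * f) = 0.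
    rewrite rmorphB !rmorphM /= !map_polyZ Hh Mk fgh qgk -!mul_polyC; ring.
  have [s [r [s0 sr]]] := divide_coefficients red mod0.
  exists (s *: (b *: H)), r; split.
    rewrite /= algebraic_reductionE !map_polyZ Hh !hornerZ.
    by rewrite !map_polyZ !hornerZ !mulf_neq0 ?fmorph_eq0.
  have := congr1 (horner^~ y) sr; rewrite hornerZ -!eval_polyE /= => <-.
  rewrite -!mul_polyC !(rmorphM, rmorphB) /= f0 mulr0 subr0 !eval_polyC; ring.
- have : x \in <<1; z>>%VS by rewrite Lz memvf.
  move=> /Fadjoin_polyP[_ /polyOver1P[P ->] xP].
  have [c [H [c0 HP]]] := clear_denominators red P.
  exists H, c%:P; rewrite /= !algebraic_reductionE map_polyC /= map_polyC hornerC.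
  by rewrite fmorph_eq0 c0 HP map_polyZ hornerZ -xP.
Qed.

End AdjoinRoot.

End Algebraic.

(** For algebraic [y] with minimal polynomial [f], the primes to be avoided are those
    where the leading coefficient of [f], the derivative of [f] at [y] or the given
    element may vanish; each of these divides a nonzero element of the image of [psi]. *)
Theorem has_reductions_adjoin (A_domain : GRing.integral_domain_axiom A)
    (char0 : forall n, (n.+1%:R : A) != 0)
    (R : idomainType) (psi : {rmorphism R -> A}) (y : A) :
  has_reductions psi -> has_reductions (eval_poly psi y).
Proof.
move=> redpsi a a0.
have [tr|] := pselect (forall q, eval_poly psi y q = 0 -> map_poly psi q = 0).
  have [i ai] : exists i, psi a`_i != 0.
    apply: contrapT => na; move: a0; rewrite /= eval_polyE.
    have -> : map_poly psi a = 0; last by rewrite horner0 eqxx.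
    apply/polyP => i; rewrite coef_map coef0; apply/eqP/negPn/negP => ai.
    by apply: na; exists i.
  have [N N0 Np] := redpsi _ ai; exists N => // p pp pN.
  have [K [phi [red phia]]] := Np p pp pN.
  exists {fraction {poly K}}, (transcendental_reduction phi); split.
    exact: reduction_transcendental.
  rewrite /= transcendental_reductionE tofrac_eq0.
  by apply: contraNneq phia => /polyP/(_ i); rewrite coef_map coef0 => ->.
move=> /existsNP[q /not_implyP[q0 nq]].
have [f fmin] := exists_minimal_annihilator q0 nq.
have e0 : eval_poly psi y (a * f^`()) != 0.
  by rewrite rmorphM; apply: domain_mulf_neq0 => //; exact: eval_deriv_neq0.
have [u [r [r0 eur]]] := minimal_multiple A_domain fmin e0.
have lr0 : psi (lead_coef f * r) != 0.
  by rewrite rmorphM; apply: domain_mulf_neq0 => //; case: fmin.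
have [N N0 Np] := redpsi _ lr0; exists N => // p pp pN.
have [K [phi [red philr]]] := Np p pp pN.
move: philr; rewrite rmorphM mulf_eq0 negb_or => /andP[phil phir].
have [|g g_irr gf] := @irreducible_factor K (map_poly phi f).
  by rewrite size_poly_eq ?annihilator_size //; exact: annihilator_size fmin.
have [L _ [z gz Lz]] := irredp_FAdjoin g_irr.
pose phi' : {rmorphism {poly R} -> L} := algebraic_reduction phi z.
have : phi' (a * f^`() * u) != 0.
  suff -> : phi' (a * f^`() * u) = phi' r%:P.
    by rewrite /phi' /= algebraic_reductionE map_polyC /= map_polyC hornerC fmorph_eq0.
  have : phi' (a * f^`() * u - r%:P) = 0.
    apply: (algebraic_reduction_eval0 fmin red phil gf gz).
    by rewrite rmorphB rmorphM /= eur eval_polyC subrr.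
  by rewrite rmorphB => /subr0_eq.
rewrite !rmorphM !mulf_eq0 !negb_or => /andP[/andP[a'0 f'0] _].
exists L, phi'; split=> //.
exact: (reduction_algebraic fmin red phil g_irr gf gz Lz).
Qed.

End Reduction.

(** * Subrings with reductions modulo almost all primes *)

Section SmallestSubring.
Variable A : comNzRingType.
Implicit Types (G C E T : set A).

Lemma subring_smallest G : subring (smallest subring G).
Proof.
split=> [T [TS _]|x y Gx Gy T TP|x y Gx Gy T TP]; first exact: (subring1 TS).
  by apply: (subringB TP.1); [apply: Gx | apply: Gy].
by apply: (subringM TP.1); [apply: Gx | apply: Gy].
Qed.

Lemma smallest_subring_finite C G E : generated_over C G -> finite_set E ->
  exists c, [/\ finite_set c, c `<=` C & E `<=` smallest subring (c `|` G)].
Proof.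
move=> gen finE.
have mono (c c' : set A) : c `<=` c' ->
    smallest subring (c `|` G) `<=` smallest subring (c' `|` G).
  move=> cc' x h T [TS TG]; apply: h; split=> // y [/cc' c'y|Gy]; apply: TG.
    by left.
  by right.
have /choice[c cP] : forall x, exists c,
    [/\ finite_set c, c `<=` C & smallest subring (c `|` G) x].
  apply: gen => [|x Cx|x Gx].
  - split=> [|x y|x y].
    + by exists set0; split=> //; exact: subring1 (subring_smallest _).
    + move=> [c [fc cC cx]] [c' [fc' c'C cy]]; exists (c `|` c').
      split; [by rewrite finite_setU|by move=> z [/cC|/c'C]|].
      apply: (subringB (subring_smallest _)).
        by apply: mono cx => z; left.
      by apply: mono cy => z; right.
    + move=> [c [fc cC cx]] [c' [fc' c'C cy]]; exists (c `|` c').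
      split; [by rewrite finite_setU|by move=> z [/cC|/c'C]|].
      apply: (subringM (subring_smallest _)).
        by apply: mono cx => z; left.
      by apply: mono cy => z; right.
  - exists [set x]; split=> [|_ -> //|T [_ TG]]; first exact: finite_set1.
    by apply: TG; left.
  - by exists set0; split=> // T [_ TG]; apply: TG; right.
exists (\bigcup_(x in E) c x); split=> [|x [y Ey]|x Ex].
- by apply: bigcup_finite => // x _; have [] := cP x.
- by have [_ + _] := cP y; exact.
- have [_ _] := cP x; apply: mono => y cy; by exists x.
Qed.

Lemma subring_range (R : nzRingType) (psi : {rmorphism R -> A}) : subring (range psi).
Proof.
split=> [|_ _ [a _ <-] [b _ <-]|_ _ [a _ <-] [b _ <-]].
- by exists 1; rewrite ?rmorph1.
- by exists (a - b); rewrite ?rmorphB.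
- by exists (a * b); rewrite ?rmorphM.
Qed.

Lemma exists_reductions (A_domain : GRing.integral_domain_axiom A)
    (char0 : forall n, (n.+1%:R : A) != 0) (h : seq A) :
  exists (R : idomainType) (psi : {rmorphism R -> A}),
    has_reductions psi /\ range psi = smallest subring [set` h].
Proof.
suff [R [psi [red hR Rh]]] : exists (R : idomainType) (psi : {rmorphism R -> A}),
    [/\ has_reductions psi, [set` h] `<=` range psi
      & forall T, subring T -> [set` h] `<=` T -> range psi `<=` T].
  exists R, psi; split=> //; apply/seteqP; split=> [x xR T [TS hT]|x].
    exact: (Rh T TS hT).
  by apply; split; first exact: subring_range.
elim: h => [|y h [R [psi [red hR Rh]]]].
  exists int, (intr : {rmorphism int -> A}).
  split=> [|//|T TS _ _ [z _ <-]]; first exact: has_reductions_int.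
  have Tnat n : T n%:R.
    elim: n => [|n IH]; first exact: (subring0 TS).
    by rewrite -natr1; apply: (subringD TS) => //; exact: (subring1 TS).
  case: (intP z) => [|n|n]; [exact: (Tnat 0%N)|exact: (Tnat n.+1)|].
  by rewrite rmorphN; apply: (subringN TS); exact: (Tnat n.+1).
exists {poly R}, (eval_poly psi y); split=> [|x|T TS hT].
- exact: has_reductions_adjoin.
- rewrite /= inE => /predU1P[->|/hR[a _ <-]].
    by exists 'X => //=; rewrite eval_polyX.
  by exists a%:P => //=; rewrite eval_polyC.
- have Ty : T y by apply: hT; rewrite /= mem_head.
  have TR : range psi `<=` T.
    by apply: Rh => // x hx; apply: hT; rewrite /= inE (hx : x \in h) orbT.
  move=> _ [q _ <-] /=; elim/poly_ind: q => [|q c IH].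
    by rewrite rmorph0; exact: (subring0 TS).
  rewrite rmorphD rmorphM /= eval_polyX eval_polyC.
  apply: (subringD TS); first exact: (subringM TS).
  by apply: TR; exists c.
Qed.

End SmallestSubring.

(** * Derivations modulo a prime *)

Section Covers.
Variables (A : comNzRingType) (R : idomainType) (psi : {rmorphism R -> A}).
Variables (p : nat) (K : fieldType) (phi : {rmorphism R -> K}).
Hypothesis red : reduction psi p phi.

Definition ker_phi : {pred R} := fun q => phi q == 0.

Lemma ker_phi_idealr : idealr_closed ker_phi.
Proof.
split; rewrite ?inE /ker_phi -?topredE /= ?rmorph0 ?rmorph1 ?oner_eq0 //.
move=> a u v; rewrite -!topredE /= => /eqP u0 /eqP v0.
by rewrite rmorphD rmorphM u0 v0 mulr0 addr0.
Qed.

Lemma ker_phi_prime : prime_idealr_closed ker_phi.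
Proof. by move=> u v; rewrite -!topredE /= /ker_phi rmorphM mulf_eq0. Qed.

HB.instance Definition _ := isIdealr.Build R ker_phi ker_phi_idealr.
HB.instance Definition _ := isPrimeIdealrClosed.Build R ker_phi ker_phi_prime.

Definition quotient_ring : comNzRingType := {ideal_quot ker_phi}.

Definition quot_map : {rmorphism R -> quotient_ring} := \pi_{ideal_quot ker_phi}%qT.

Lemma quotient_ring_domain : GRing.integral_domain_axiom quotient_ring.
Proof. exact: Quotient.rquot_IdomainAxiom. Qed.

Lemma quot_map_surj x : exists q, quot_map q = x.
Proof. by exists (repr x); exact: reprK. Qed.

Lemma quot_map_eq0 q : (quot_map q == 0) = (phi q == 0).
Proof.
by rewrite -[0](rmorph0 quot_map) -[LHS]Quotient.idealrBE subr0.
Qed.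

Local Notation Q := quotient_ring.

Definition liftable (d : A -> A) := forall q, exists q', psi q' = d (psi q).

(** [D] is the map that [d] induces modulo the prime, expressed through
    representatives in [R] of the elements of the image of [psi]. *)
Definition covers (d : A -> A) (D : Q -> Q) :=
  forall q q', psi q' = d (psi q) -> D (quot_map q) = quot_map q'.

Lemma quot_map_psi0 q : psi q = 0 -> quot_map q = 0.
Proof.
by have [_ psi0 _ _] := red => /psi0/eqP; rewrite -quot_map_eq0 => /eqP.
Qed.

(** If [phi u] vanishes, then [psi (s * u)] is a multiple of [p] with [phi s] nonzero,
    so [d] maps it to a multiple of [p]; by the Leibniz rule [psi s * d (psi u)] is then
    congruent to a multiple of [psi u] modulo [p]. *)
Lemma derivation_ker_phi d u u' : derivation d -> liftable d ->
  phi u = 0 -> psi u' = d (psi u) -> phi u' = 0.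
Proof.
move=> [dA dM] dl u0 uu'; have [p0 psi0 divp _] := red.
have [s [t [s0 st]]] := divp u u0.
have [s' ss'] := dl s; have [t' tt'] := dl t.
have /psi0 : psi (s' * u + s * u' - p%:R * t') = 0.
  rewrite rmorphB rmorphD !rmorphM /= ss' tt' uu' -dM -rmorphM st.
  by rewrite rmorph_nat mulr_natl (mapMn dA) mulr_natl subrr.
rewrite rmorphB rmorphD !rmorphM /= u0 mulr0 add0r rmorph_nat p0 mul0r subr0.
by move=> /eqP; rewrite mulf_eq0 (negPf s0) => /eqP.
Qed.

Lemma exists_cover d : derivation d -> liftable d -> exists D, covers d D.
Proof.
move=> dD dl; have /choice[lift liftP] := dl.
exists (fun x => quot_map (lift (repr x))) => q q' qq'.
apply/eqP; rewrite -subr_eq0 -rmorphB quot_map_eq0; apply/eqP.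
apply: (@derivation_ker_phi d (repr (quot_map q) - q)) => //.
  apply/eqP; rewrite -quot_map_eq0 rmorphB subr_eq0; apply/eqP.
  by rewrite [LHS]reprK.
by rewrite !rmorphB /= liftP qq' dD.1.
Qed.

Lemma covers_derivation d D : derivation d -> liftable d -> covers d D -> derivation D.
Proof.
move=> [dA dM] dl dD; split=> x y;
    have [q <-] := quot_map_surj x; have [r <-] := quot_map_surj y.
  have [q' qq'] := dl q; have [r' rr'] := dl r.
  rewrite -rmorphB (dD q q') // (dD r r') // -rmorphB; apply: dD.
  by rewrite !rmorphB /= dA qq' rr'.
have [q' qq'] := dl q; have [r' rr'] := dl r.
rewrite -rmorphM (dD q q') // (dD r r') // -!rmorphM -rmorphD; apply: dD.
by rewrite rmorphD !rmorphM /= dM qq' rr'.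
Qed.

Lemma liftable_bracket d e : liftable d -> liftable e -> liftable (bracket d e).
Proof.
move=> dl el q; have [e1 e1P] := el q; have [d1 d1P] := dl q.
have [e2 e2P] := el d1; have [d2 d2P] := dl e1.
by exists (d2 - e2); rewrite rmorphB /= d2P e2P e1P d1P.
Qed.

Lemma covers_bracket d e D E : liftable d -> liftable e ->
  covers d D -> covers e E -> covers (bracket d e) (bracket D E).
Proof.
move=> dl el dD eE q q' qq'; have [e1 e1P] := el q; have [d1 d1P] := dl q.
have [e2 e2P] := el d1; have [d2 d2P] := dl e1.
rewrite /bracket (eE _ _ e1P) (dD _ _ d1P) (eE _ _ e2P) (dD _ _ d2P).
rewrite -rmorphB; apply/subr0_eq; rewrite -rmorphB; apply: quot_map_psi0.
by rewrite !rmorphB /= d2P e2P e1P d1P qq' subrr.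
Qed.

Lemma covers_iter d D n q q' : liftable d -> covers d D ->
  psi q' = iter n d (psi q) -> iter n D (quot_map q) = quot_map q'.
Proof.
move=> dl dD; elim: n q' => [|n IH] q' /= qq'.
  by apply/subr0_eq; rewrite -rmorphB; apply: quot_map_psi0; rewrite rmorphB /= qq' subrr.
have [r rP] : exists r, psi r = iter n d (psi q).
  elim: n {IH qq'} => [|n [r rP]]; first by exists q.
  by have [r' r'P] := dl r; exists r'; rewrite r'P rP.
by rewrite (IH r) //; apply: dD; rewrite rP.
Qed.

Lemma covers_derived (M : set (A -> A)) k : bracket_closed M ->
    (forall d, M d -> derivation d /\ liftable d) ->
  forall w, derived_brackets M k w -> exists2 W,
    derived_brackets [set D : Q -> Q | exists2 d, M d & covers d D] k W & covers w W.
Proof.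
move=> Mbr MP.
have sub j : derived_brackets M j `<=` M.
  elim: j => // j IH; rewrite derived_bracketsSr => _ [d /IH Md] [e /IH Me <-].
  exact: Mbr.
elim: k => [|k IH] w.
  move=> Mw; have [D wD] := exists_cover (MP w Mw).1 (MP w Mw).2.
  by exists D => //; exists w.
rewrite !derived_bracketsSr => -[d Md] [e Me <-].
have [D DD dD] := IH d Md; have [E EE eE] := IH e Me.
exists (bracket D E); first by exists D => //; exists E.
by apply: covers_bracket => //; [have [] := MP d (sub _ _ Md)|have [] := MP e (sub _ _ Me)].
Qed.

End Covers.

(** * Solvability *)

Lemma derived_brackets_finite (V : zmodType) (L : set (V -> V)) k w :
  derived_brackets L k w -> exists Y, [/\ finite_set Y, Y `<=` L & derived_brackets Y k w].
Proof.
have mono (Y Z : set (V -> V)) j :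
    Y `<=` Z -> derived_brackets Y j `<=` derived_brackets Z j.
  elim: j Y Z => // j IH Y Z YZ; rewrite !derived_bracketsSr => _ [d Yd] [e Ye <-].
  by exists d; [exact: IH Yd | exists e => //; exact: IH Ye].
elim: k w => [|k IH] w.
  by move=> Lw; exists [set w]; split=> [|_ ->|]; first exact: finite_set1.
rewrite derived_bracketsSr => -[d /IH[Y [fY YL Yd]]] [e /IH[Z [fZ ZL Ze]] <-].
exists (Y `|` Z); split; [by rewrite finite_setU|by move=> f [/YL|/ZL]|].
rewrite derived_bracketsSr; exists d; first by apply: mono Yd => f; left.
by exists e => //; apply: mono Ze => f; right.
Qed.

(** In the second case [s] is required to lie in [G] so that the relation [x * s = 1]
    persists in a subring generated by [G], and in its quotients. *)
Definition tame (A : comNzRingType) (L : set (A -> A)) (G : set A) (x : A) :=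
  (forall d, L d -> nil_at d x) \/
  exists s, [/\ G s, x * s = 1 & forall d, L d -> nil_at d s].

(** A derived bracket involves finitely many elements of [L] and these restrict to
    a finitely generated subring. If the bracket did not vanish, it would survive
    modulo some prime, where [engel] makes the Lie algebra nilpotent and
    [derived_brackets_eq0] bounds its derived length. *)
Theorem derived_brackets_char0 (A : comNzRingType)
    (A_domain : GRing.integral_domain_axiom A)
    (char0 : forall n, (n.+1%:R : A) != 0) (L : set (A -> A)) m (g : 'I_m -> A) :
    derivations L -> bracket_closed L -> generated_over (constants L) (range g) ->
    (forall j, tame L (range g) (g j)) ->
  forall w, derived_brackets L m w -> forall a, w a = 0.
Proof.
move=> LD Lbr gen gtame w /derived_brackets_finite[Y [finY YL Yw]].
pose E := [set d (g j) | d in Y & j in [set: 'I_m]].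
have finE : finite_set E by apply: finite_image2.
have [c [finc cL cE]] := smallest_subring_finite gen finE.
have fing : finite_set (range g) by apply: finite_image.
have /finite_seqP[h hE] : finite_set (c `|` range g) by rewrite finite_setU.
have [R [psi [red rpsi]]] := exists_reductions A_domain char0 h.
rewrite -hE in rpsi.
have Bsub := subring_range psi.
pose M := smallest (@bracket_closed A) Y.
have ML : M `<=` L by move=> d; apply; split.
have YM : Y `<=` M by move=> d Yd T [_]; apply.
have Mbr : bracket_closed M.
  by move=> d e Md Me T TP; apply: TP.1; [apply: Md|apply: Me].
have Ml d : M d -> liftable psi d.
  apply; split=> [|{}d Yd q]; first exact: liftable_bracket.
  have LDd := LD d (YL d Yd).
  suff h1 : range psi `<=` [set x | range psi x /\ range psi (d x)].
    have [|_ [q' _ qq']] := h1 (psi q); first by exists q.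
    by exists q'.
  rewrite {1}rpsi => x; apply; split.
    split=> [|x1 x2 [B1 Bd1] [B2 Bd2]|x1 x2 [B1 Bd1] [B2 Bd2]].
    - by split; [exact: (subring1 Bsub) | rewrite derivation1 //; exact: (subring0 Bsub)].
    - by split; [exact: (subringB Bsub)|rewrite LDd.1; exact: (subringB Bsub)].
    - split; first exact: (subringM Bsub).
      by rewrite LDd.2; apply: (subringD Bsub); exact: (subringM Bsub).
  move=> y hy; split; first by rewrite rpsi => T [_]; apply.
  case: hy => [/cL cy|[j _ <-]].
    by rewrite (cy d (YL d Yd)); exact: (subring0 Bsub).
  by rewrite rpsi; apply: cE; exists d => //; exists j.
have MD : derivations M by move=> d /ML/LD.
have Mw : derived_brackets M m w.
  elim: (m) w Yw => [|k IH] w'; first exact: YM.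
  rewrite !derived_bracketsSr => -[d /IH Md] [e /IH Me <-].
  by exists d => //; exists e.
have subM j : derived_brackets M j `<=` M.
  elim: j => // j IH; rewrite derived_bracketsSr => _ [d /IH Md] [e /IH Me <-].
  exact: Mbr.
have wD := MD w (subM _ _ Mw); have wl := Ml w (subM _ _ Mw).
have lift_g j : exists q, psi q = g j.
  have : range psi (g j) by rewrite rpsi => T [_]; apply; right; exists j.
  by move=> [q _ qg]; exists q.
suff wg j : w (g j) = 0.
  apply: gen => [|x /(_ w (ML _ (subM _ _ Mw)))//|_ [j _ <-]]; last exact: wg.
  split=> [|x y x0 y0|x y x0 y0]; first exact: derivation1.
    by rewrite wD.1 x0 y0 subrr.
  by rewrite wD.2 x0 y0 mul0r mulr0 addr0.
apply/eqP/negPn/negP => wgj.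
have [q qg] := lift_g j; have [q' qq'] := wl q.
have [|N N0 Np] := red q'; first by rewrite qq' qg.
have [p Np1 pp] := prime_above N.
have [|K [phi [redp phiq']]] := Np p pp; first by rewrite gtnNdvd.
pose LQ := [set D : quotient_ring phi -> quotient_ring phi |
  exists2 d, M d & covers psi d D].
have LQD : derivations LQ.
  by move=> D [d Md]; apply: (covers_derivation (MD d Md) (Ml d Md)).
have LQbr : bracket_closed LQ.
  move=> D1 D2 [d Md dD] [e Me eE]; exists (bracket d e); first exact: Mbr.
  by apply: (covers_bracket redp _ _ dD eE); apply: Ml.
have p0 : (p%:R : quotient_ring phi) = 0.
  have [p0 _ _ _] := redp.
  by apply/eqP; rewrite -(rmorph_nat (quot_map phi)) quot_map_eq0 rmorph_nat p0.
have /choice[gq gqP] := lift_g.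
pose gQ j := quot_map phi (gq j).
have genQ : generated_over (constants LQ) (range gQ).
  move=> T TS CT gT x; have [r <-] := quot_map_surj x.
  have h1 : range psi `<=` [set y | exists2 r, psi r = y & T (quot_map phi r)].
    rewrite {1}rpsi => y; apply; split.
      split=> [|_ _ [r1 <- T1] [r2 <- T2]|_ _ [r1 <- T1] [r2 <- T2]].
      - by exists 1; rewrite rmorph1 //; exact: (subring1 TS).
      - by exists (r1 - r2); rewrite rmorphB //; exact: (subringB TS).
      - by exists (r1 * r2); rewrite rmorphM //; exact: (subringM TS).
    move=> z [cz|[i _ <-]]; last by exists (gq i) => //; apply: gT; exists i.
    have [rz rzP] : exists r, psi r = z.
      have : range psi z by rewrite rpsi => T' [_]; apply; left.
      by move=> [r' _ r'z]; exists r'.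
    exists rz => //; apply: CT => D [d Md dD].
    by rewrite (dD rz 0) ?rmorph0 // rzP (cL _ cz d (ML _ Md)).
  have [|r' r'r Tr'] := h1 (psi r); first by exists r.
  suff -> : quot_map phi r = quot_map phi r' by [].
  apply/subr0_eq; rewrite -rmorphB; apply: (quot_map_psi0 redp).
  by rewrite rmorphB /= r'r subrr.
have domQ := @quotient_ring_domain R K phi.
have p_gt0 := prime_gt0 pp.
have nilQ D : LQ D -> forall x, nil_at D x.
  move=> [d Md dD]; have DD : derivation D by apply: LQD; exists d.
  have nil_lift r : nil_at d (psi r) -> nil_at D (quot_map phi r).
    move=> [n nr]; exists n.
    by rewrite (covers_iter (q' := 0) redp (Ml d Md) dD) ?rmorph0.
  apply: genQ => [|x cx|_ [i _ <-]]; first exact: (subring_nil_at DD).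
    by exists 1%N; rewrite /= cx //; exists d.
  case: (gtame i) => [gnil|[_ [[i' _ <-] gs snil]]].
    by apply: nil_lift; rewrite gqP; apply: gnil; exact: ML.
  apply: (nil_at_inverse p_gt0 p0 DD (x := gQ i')); last first.
    by apply: nil_lift; rewrite gqP; apply: snil; exact: ML.
  rewrite -rmorphM -(rmorph1 (quot_map phi)); apply/subr0_eq; rewrite -rmorphB.
  apply: (quot_map_psi0 redp).
  by rewrite rmorphB rmorphM rmorph1 /= !gqP mulrC gs subrr.
have [n dep] := dependent_over_pchar domQ p_gt0 p0 LQD genQ.
have killQ := engel domQ (derivations_additive LQD) (linear_over_constants LQD)
  LQbr nilQ dep.
have [W LW wW] := covers_derived redp Mbr
  (fun d Md => conj (MD d Md) (Ml d Md)) Mw.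
have W0 := derived_brackets_eq0 domQ LQD LQbr killQ genQ LW.
move/negP: phiq'; apply; rewrite -(quot_map_eq0 phi) -(wW q q') //.
by rewrite W0.
Qed.

(** * Conjugation by the exponential of a nilpotent map *)

(** If [f] is a polynomial of degree [m], then [2 ^ m f (s) - f (2 s)] has degree less
    than [m], and its coefficients are positive multiples of those of [f]. *)
Lemma polynomial_values_coef (V : zmodType) (N : set V) :
    (forall x y, N x -> N y -> N (x - y)) -> (forall x n, N (x *+ n.+1) -> N x) ->
  forall m (w : nat -> V), (forall s, N (\sum_(k < m) w k *+ s ^ k)) ->
  forall k, (k < m)%N -> N (w k).
Proof.
move=> NB Npure m; elim: m => // m IH w Nw.
have Nlow k : (k < m)%N -> N (w k).
  move=> km; apply: (Npure _ (2 ^ m - 2 ^ k).-1); rewrite prednK; last first.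
    by rewrite subn_gt0 ltn_exp2l.
  move: k km; apply: (IH (fun k => w k *+ (2 ^ m - 2 ^ k))) => s.
  have N0 : N 0 by rewrite -(subrr (\sum_(k < m.+1) w k *+ 0 ^ k)); exact: NB.
  have NMn x n : N x -> N (x *+ n).
    move=> Nx; elim: n => [|n IHn]; first by rewrite mulr0n.
    by rewrite mulrSr -[x in _ + x]opprK -[- x]sub0r; apply: NB IHn (NB _ _ N0 Nx).
  have := NB _ _ (NMn _ (2 ^ m)%N (Nw s)) (Nw (2 * s)%N).
  rewrite !big_ord_recr /= mulrnDl -!mulrnA expnMn [(s ^ m * 2 ^ m)%N]mulnC.
  rewrite opprD addrACA subrr addr0 -sumrMnl -sumrB; congr N; apply: eq_bigr => k _.
  have km : (2 ^ k <= 2 ^ m)%N by rewrite leq_exp2l // ltnW.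
  rewrite -!mulrnA expnMn mulnBl mulrnBr ?leq_mul2r ?km ?orbT //.
  by rewrite [(s ^ k * _)%N]mulnC.
move=> k; rewrite ltnS leq_eqVlt => /predU1P[->|]; last exact: Nlow.
have := Nw 1%N; rewrite big_ord_recr /= exp1n mulr1n => Nsum.
have Nlowsum j : (j <= m)%N -> N (\sum_(k < j) w k *+ 1 ^ k).
  elim: j => [|j IHj] jm.
    by rewrite big_ord0 -(subrr (\sum_(k < m.+1) w k *+ 0 ^ k)); apply: NB.
  rewrite big_ord_recr /= exp1n mulr1n.
  have := NB _ _ (IHj (ltnW jm)) (NB _ _ (NB _ _ (Nlow j jm) (Nlow j jm)) (Nlow j jm)).
  by rewrite subrr sub0r opprK.
by have := NB _ _ Nsum (Nlowsum m (leqnn m)); rewrite addrAC subrr add0r.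
Qed.

Lemma dvdn_fact_fact m n : (m <= n)%N -> (m`! %| n`!)%N.
Proof. by move=> mn; rewrite (fact_split mn) dvdn_mulr. Qed.

(** The map [D i] is [(- ad z) ^ i] applied to [D 0]. All identities are kept integral,
    because [V] need not be divisible. *)
Section Exponential.
Variables (V : zmodType) (z : V -> V) (D : nat -> V -> V) (c : nat).
Hypotheses (zA : GRing.zmod_morphism z) (DA : forall i, GRing.zmod_morphism (D i)).
Hypothesis DS : forall i x, D i.+1 x = D i (z x) - z (D i x).
Hypothesis Dc : forall i, (c < i)%N -> forall x, D i x = 0.

Local Notation d := (D 0).

Lemma conj_coef_iter j k v :
  D j (iter k z v) = \sum_(i < k.+1) iter (k - i) z (D (i + j) v) *+ 'C(k, i).
Proof.
elim: k j => [|k IH] j; first by rewrite big_ord1 bin0 mulr1n.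
have -> : D j (iter k.+1 z v) = z (D j (iter k z v)) + D j.+1 (iter k z v).
  by rewrite DS addrC subrK.
rewrite !IH (map_sum zA) big_ord_recl [in LHS]big_ord_recr /=.
rewrite [in RHS]big_ord_recl [in RHS]big_ord_recr /= !bin0 !subn0 !mulr1n.
rewrite !binn !subnn !mulr1n -!addrA; congr (_ + _); rewrite !addrA.
congr (_ + _); last by rewrite addnS addSn.
rewrite -big_split; apply: eq_bigr => i _ /=.
rewrite /bump /= !add1n (mapMn zA) subSS binS mulrnDr addnS addSn; congr (_ + _).
by rewrite -[z _]/(iter _.+1 z _) -subSn ?subSS // ltn_ord.
Qed.

Lemma conj_coef_nil m v : (forall k, (m <= k)%N -> iter k z v = 0) ->
  forall a i, (c + m <= a + i)%N -> iter a z (D i v) = 0.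
Proof.
move=> zv; suff h a i b : (c + m <= a + i + b)%N -> iter a z (D i (iter b z v)) = 0.
  by move=> a i ai; apply: (h a i 0%N); rewrite addn0.
elim: a i b => [|a IH] i b aib /=.
  have [ci|ic] := ltnP c i; first exact: Dc.
  by rewrite zv ?(map0 (DA i)) //; lia.
rewrite -iterS iterSr.
have -> : z (D i (iter b z v)) = D i (iter b.+1 z v) - D i.+1 (iter b z v).
  by rewrite DS opprB addrC subrK.
by rewrite (iter_additive zA) !IH ?subrr //; lia.
Qed.

(** [M`!] times the exponential of [t z], truncated after the power [M]. *)
Definition scaled_exp M t v := \sum_(k < M.+1) iter k z v *+ (M`! %/ k`! * t ^ k).

(** The conjugate [exp (- t z) d exp (t z)] of [d = D 0], which for [t] divisible by
    [c`!] is an integral combination of the [D i]. *)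
Definition conj_exp t v := \sum_(i < c.+1) D i v *+ (t ^ i %/ i`!).

Lemma scaled_exp_conj m v t M : (c`! %| t)%N -> (forall k, (m <= k)%N -> iter k z v = 0) ->
  (c + m <= M)%N -> d (scaled_exp M t v) = scaled_exp M t (conj_exp t v).
Proof.
move=> ct zv cmM; have zD := conj_coef_nil zv.
pose X i j := iter j z (D i v).
have X0 i j : (c + m <= i + j)%N -> X i j = 0.
  by move=> h; apply: zD; rewrite (addnC j).
have dvd_fact i : (i <= c)%N -> (i`! %| t ^ i)%N.
  case: i => // i ic; rewrite expnS dvdn_mulr //; apply: dvdn_trans ct.
  exact: dvdn_fact_fact.
have fact_div k : (k <= M)%N -> (M`! %/ k`! * k`! = M`!)%N.
  by move=> kM; rewrite divnK //; exact: dvdn_fact_fact.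
have -> : scaled_exp M t (conj_exp t v) = \sum_(i < M.+1 | (i < c.+1)%N)
    \sum_(j < M.+1) X i j *+ (t ^ i %/ i`! * (M`! %/ j`! * t ^ j)).
  have cM : (c.+1 <= M.+1)%N by lia.
  rewrite -(big_ord_widen _ (fun i => \sum_(j < M.+1)
    X i j *+ (t ^ i %/ i`! * (M`! %/ j`! * t ^ j))) cM).
  rewrite exchange_big /=; apply: eq_bigr => j _.
  rewrite /conj_exp (map_sum (iter_additive zA j)) -sumrMnl; apply: eq_bigr => i _.
  by rewrite (mapMn (iter_additive zA j)) [RHS]mulrnA.
have -> : d (scaled_exp M t v) = \sum_(i < M.+1) \sum_(j < M.+1 | (j < M.+1 - i)%N)
    X i j *+ ('C(j + i, i) * (M`! %/ (j + i)`! * t ^ (j + i))).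
  pose F i k := X i (k - i)%N *+ ('C(k, i) * (M`! %/ k`! * t ^ k)).
  transitivity (\sum_(k < M.+1) \sum_(i < M.+1 | (i < k.+1)%N) F i k).
    rewrite /scaled_exp (map_sum (DA 0)); apply: eq_bigr => k _.
    rewrite (mapMn (DA 0)) (conj_coef_iter 0) -(big_ord_widen _ (fun i => F i k)) //.
    by rewrite -sumrMnl; apply: eq_bigr => i _; rewrite addn0 [RHS]mulrnA.
  rewrite (exchange_big_dep xpredT) //=; apply: eq_bigr => i _.
  transitivity (\sum_(i <= k < M.+1) F i k); first by rewrite big_geq_mkord.
  rewrite -{1}[nat_of_ord i]add0n big_addn.
  rewrite big_mkord (big_ord_widen M.+1 (fun j => F i (j + i)%N)) ?leq_subr //.
  by apply: eq_bigr => j _; rewrite /F addnK.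
rewrite [RHS]big_mkcond /=; apply: eq_bigr => i _.
have [ic|ci] := ltnP i c.+1; last first.
  by rewrite big1 // => j _; rewrite /X Dc // iter_map0 // mul0rn.
rewrite big_mkcond /=; apply: eq_bigr => j _.
have [ji|ij] := ltnP j (M.+1 - i); last by rewrite X0 ?mul0rn //; lia.
congr (_ *+ _); have jiM : (j + i <= M)%N by lia.
apply/eqP; rewrite -(eqn_pmul2r (fact_gt0 i)) -(eqn_pmul2r (fact_gt0 j)); apply/eqP.
have eC : ('C(j + i, i) * (i`! * j`!) = (j + i)`!)%N.
  by rewrite -(bin_fact (leq_addl j i)) addnK.
have e1 := fact_div _ jiM.
have e2 : (M`! %/ j`! * j`! = M`!)%N by apply: fact_div; lia.
have e3 : (t ^ i %/ i`! * i`! = t ^ i)%N by rewrite divnK // dvd_fact.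
rewrite expnD.
move: (M`! %/ (j + i)`!)%N (M`! %/ j`!)%N (t ^ i %/ i`!)%N e1 e2 e3.
move=> a b k e1 e2 e3.
transitivity (M`! * (t ^ j * t ^ i))%N; first by rewrite -e1 -eC; ring.
by rewrite -e2 -e3; ring.
Qed.

Lemma conj_exp_nil m v t : (forall k, (m <= k)%N -> iter k z v = 0) ->
  forall k, (c + m <= k)%N -> iter k z (conj_exp t v) = 0.
Proof.
move=> zv k ck; rewrite (map_sum (iter_additive zA k)) big1 // => i _.
by rewrite (mapMn (iter_additive zA k)) (conj_coef_nil zv) ?mul0rn //; lia.
Qed.

Lemma iter_scaled_exp n m v t : (c`! %| t)%N ->
    (forall k, (m <= k)%N -> iter k z v = 0) ->
  exists M0, forall M, (M0 <= M)%N ->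
    iter n d (scaled_exp M t v) = scaled_exp M t (iter n (conj_exp t) v).
Proof.
move=> ct; elim: n m v => [|n IH] m v zv; first by exists 0%N.
have [M0 hM0] := IH _ _ (conj_exp_nil t zv).
exists (maxn M0 (c + m)) => M; rewrite geq_max => /andP[M0M cmM].
by rewrite iterSr (scaled_exp_conj ct zv cmM) hM0 // iterSr.
Qed.

(** Since [d] conjugated by the exponential of [t z] is nilpotent at [b], the map
    [d] is nilpotent at the exponential of [t z] applied to [b]. This is a
    polynomial in [t], hence [d] is nilpotent at each of its coefficients; the
    linear one is [z b]. *)
Theorem nil_at_of_conj_exp b : (forall (x : V) n, x *+ n.+1 = 0 -> x = 0) ->
    nil_at z b -> (forall t, (c`! %| t)%N -> nil_at (conj_exp t) b) ->
  nil_at d (z b).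
Proof.
move=> tf [m0 zb0] nilt; pose m := m0.+2.
have zb k : (m <= k)%N -> iter k z b = 0.
  by move=> mk; apply: iter_eq0 zb0 => //; rewrite /m in mk; lia.
have Npure x n : nil_at d (x *+ n.+1) -> nil_at d x.
  by move=> [k kx]; exists k; apply: (tf _ n); rewrite -(mapMn (iter_additive (DA 0) k)).
pose w k := iter k z b *+ (m`! %/ k`!).
have w_nil s : nil_at d (\sum_(k < m) (w k *+ c`! ^ k) *+ s ^ k).
  pose t := (c`! * s)%N; have ct : (c`! %| t)%N by rewrite dvdn_mulr.
  have [n nb] := nilt t ct.
  have [M0 hM0] := iter_scaled_exp n ct zb.
  pose M := maxn M0 m; have mM : (m <= M)%N by rewrite leq_maxr.
  apply: (Npure _ (M`! %/ m`!).-1); rewrite prednK; last first.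
    by rewrite divn_gt0 ?fact_gt0 // dvdn_leq ?fact_gt0 // dvdn_fact_fact.
  exists n; rewrite -[RHS](_ : iter n d (scaled_exp M t b) = 0); last first.
    rewrite hM0 ?leq_maxl // nb /scaled_exp big1 // => k _.
    by rewrite iter_map0 // mul0rn.
  congr (iter n d _); rewrite -sumrMnl /scaled_exp.
  have mM1 : (m <= M.+1)%N by rewrite leqW.
  rewrite (big_ord_widen _ (fun k => w k *+ c`! ^ k *+ s ^ k *+ (M`! %/ m`!)) mM1).
  rewrite big_mkcond; apply: eq_bigr => k _.
  case: ltnP => [km|mk]; last by rewrite zb ?mul0rn.
  rewrite /w -!mulrnA; congr (_ *+ _).
  have e1 : (M`! %/ k`! * k`! = M`!)%N by rewrite divnK // dvdn_fact_fact // -ltnS.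
  have e2 : (M`! %/ m`! * m`! = M`!)%N by rewrite divnK // dvdn_fact_fact.
  have e3 : (m`! %/ k`! * k`! = m`!)%N by rewrite divnK // dvdn_fact_fact // ltnW.
  apply/eqP; rewrite -(eqn_pmul2r (fact_gt0 k)); apply/eqP.
  rewrite /t expnMn.
  move: (M`! %/ k`!)%N (M`! %/ m`!)%N (m`! %/ k`!)%N e1 e2 e3 => a1 a2 a3 e1 e2 e3.
  transitivity (M`! * (c`! ^ k * s ^ k))%N; last by rewrite -e1; ring.
  by rewrite -e2 -e3; ring.
have NB x y : nil_at d x -> nil_at d y -> nil_at d (x - y) by exact: nil_atB.
have := @polynomial_values_coef V _ NB Npure m (fun k => w k *+ c`! ^ k) w_nil 1%N isT.
rewrite /= expn1 /w divn1 -mulrnA -[X in _ *+ X]prednK; first exact: Npure.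
by rewrite muln_gt0 !fact_gt0.
Qed.

End Exponential.

(** * Nilpotency by filtrations *)

Section Filtrations.
Variables (Phi : comPzRingType) (A : comUnitAlgType Phi).
Implicit Types (d e f z : A -> A) (L J M X Y : set (A -> A)) (F : nat -> set (A -> A)).

Lemma submoduleP M : submodule M <->
  M 0 /\ forall k d e, M d -> M e -> M (k *: d + e).
Proof.
split=> [[M0 MZ]|[M0 MZ]].
  split; first by rewrite in_setE in M0.
  by move=> k d e Md Me; have := MZ k d e; rewrite !in_setE; apply.
by split=> [|k d e]; rewrite ?in_setE //; apply: MZ.
Qed.

Section Submodule.
Variables (M : set (A -> A)) (Msub : submodule M).
Lemma submodule0 : M 0. Proof. exact: ((submoduleP M).1 Msub).1. Qed.
Lemma submoduleZD k d e : M d -> M e -> M (k *: d + e).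
Proof. exact: ((submoduleP M).1 Msub).2. Qed.
Lemma submoduleD d e : M d -> M e -> M (d + e).
Proof. by move=> Md Me; rewrite -[d]scale1r; exact: submoduleZD. Qed.
Lemma submoduleZ k d : M d -> M (k *: d).
Proof. by move=> Md; rewrite -[_ *: _]addr0; apply: submoduleZD submodule0. Qed.
Lemma submoduleB d e : M d -> M e -> M (d - e).
Proof. by move=> Md Me; rewrite addrC -scaleN1r; exact: submoduleZD. Qed.
Lemma submoduleMn d n : M d -> M (d *+ n).
Proof. by move=> Md; rewrite -scaler_nat; apply: submoduleZ. Qed.
End Submodule.

Lemma submodule_smallest X : submodule (smallest (@submodule Phi A) X).
Proof.
apply/submoduleP; split=> [T [TS _]|k d e Xd Xe T TP]; first exact: submodule0.
by apply: (submoduleZD TP.1); [exact: Xd | exact: Xe].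
Qed.

Lemma submodule_linear : submodule [set d : A -> A | linear d].
Proof.
apply/submoduleP; split=> [k x y|k d e dl el h x y] /=.
  by rewrite scaler0 addr0.
by rewrite !fctE dl el !scalerDr !scalerA (mulrC k h) addrACA.
Qed.

Lemma linear_additive d : linear d -> GRing.zmod_morphism d.
Proof. by move=> dl x y; rewrite addrC -scaleN1r dl scaleN1r addrC. Qed.

Lemma linearZ_map d k x : linear d -> d (k *: x) = k *: d x.
Proof. by move=> dl; rewrite -[k *: x]addr0 dl (map0 (linear_additive dl)) addr0. Qed.

Lemma bracket_linearl k d e f : linear f ->
  bracket (k *: d + e) f = k *: bracket d f + bracket e f.
Proof.
move=> fl; apply/funext => x; rewrite /bracket !fctE fl.
by rewrite scalerBr opprD addrACA.
Qed.

Lemma bracket_linearr k d e f : linear f ->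
  bracket f (k *: d + e) = k *: bracket f d + bracket f e.
Proof.
move=> fl; apply/funext => x; rewrite /bracket !fctE fl.
by rewrite scalerBr opprD addrACA.
Qed.

Lemma bracket0l f : linear f -> bracket 0 f = 0.
Proof.
move=> fl; apply/funext => x; rewrite /bracket.
have -> : f ((0 : A -> A) x) = 0 by exact: map0 (linear_additive fl).
exact: subrr.
Qed.

Lemma bracket0r f : linear f -> bracket f 0 = 0.
Proof.
move=> fl; apply/funext => x; rewrite /bracket.
have -> : f ((0 : A -> A) x) = 0 by exact: map0 (linear_additive fl).
exact: subrr.
Qed.

Lemma bracketN d e : bracket d e = - bracket e d.
Proof. by apply/funext => x; rewrite /bracket !fctE opprB. Qed.

Lemma bracketdd d : bracket d d = 0.
Proof. by apply/funext => x; rewrite /bracket subrr. Qed.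

Lemma bracket_linear d e : linear d -> linear e -> linear (bracket d e).
Proof. by move=> dl el k x y; rewrite /bracket !(dl, el) scalerBr opprD addrACA. Qed.

(** The index is the weight minus one: [F 0] is the whole Lie algebra, and weights
    add up in brackets. *)
Definition nil_filtration F n :=
  [/\ forall w, submodule (F w), forall w f, F w f -> linear f,
      forall w, F w.+1 `<=` F w,
      forall v w d e, F v d -> F w e -> F (v + w).+1 (bracket d e)
    & F n `<=` [set 0]].

Definition nilpotent_set Y := exists F n, nil_filtration F n /\ Y `<=` F 0%N.

Definition locally_nilpotent_set J :=
  forall Y, finite_set Y -> Y `<=` J -> nilpotent_set Y.

Lemma nil_filtration_le F n v w : nil_filtration F n -> (v <= w)%N -> F w `<=` F v.
Proof.
move=> [_ _ Fdec _ _] /subnK <-; elim: (w - v)%N => // k IH f Ff.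
by apply: IH; apply: Fdec.
Qed.

Lemma nilpotent_set_sub X Y : X `<=` Y -> nilpotent_set Y -> nilpotent_set X.
Proof. by move=> XY [F [n [FP YF]]]; exists F, n; split=> // d /XY/YF. Qed.

Lemma nilpotent_set_lie_nilpotent X : nilpotent_set X ->
  lie_nilpotent (smallest (@lie_closed Phi A) X).
Proof.
move=> [F [n [FP XF]]]; have [Fsub _ _ Fbr Fn] := FP.
set M := smallest _ X.
have MF : M `<=` F 0%N.
  move=> d; apply; split=> //; split; first exact: Fsub.
  by move=> f g Ff Fg; apply: (nil_filtration_le FP (leq0n _)) (Fbr _ _ _ _ Ff Fg).
exists n; have lower k : lower_central M k `<=` F k.
  elim: k => // k IH d; apply; split; first exact: Fsub.
  move=> _ [f Mf] [g Mg <-]; rewrite -[k in F k.+1]addn0.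
  exact: Fbr (IH _ Mf) (MF _ Mg).
apply/seteqP; split=> [d /lower/Fn//|_ ->].
case: n {Fn FP} => [|n] /=.
  by move=> T [[Tsub _] _]; exact: submodule0.
exact: submodule0 (submodule_smallest _).
Qed.

(** The powers of the associative algebra generated by [L] form a filtration. *)
Lemma killed_by_words_nilpotent_set L n : (forall d, L d -> linear d) ->
  killed_by_words L n -> nilpotent_set L.
Proof.
move=> Llin Ln; have LA : additive_maps L by move=> d /Llin/linear_additive.
pose W w := [set word u | u in [set u : seq (A -> A) | all [in L] u /\ (w < size u)%N]].
pose F w := smallest (@submodule Phi A) (W w).
have Fsub w : submodule (F w) by exact: submodule_smallest.
have wlin u : all [in L] u -> linear (word u).
  elim: u => // d u IH /andP[/set_mem/Llin dl /IH ul] k x y.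
  by rewrite [LHS]/= ul dl.
have Flin w f : F w f -> linear f.
  apply; split; first exact: submodule_linear.
  by move=> _ [u [Lu _] <-]; apply: wlin.
have comp v w f g : F v f -> F w g -> F (v + w).+1 (f \o g).
  move=> Ff Fg; have glin := Flin _ _ Fg.
  suff: [set f : A -> A | F (v + w).+1 (f \o g)] f by [].
  apply: Ff; split=> [|_ [u [Lu su] <-]].
    apply/submoduleP; split=> [|k f1 f2 F1 F2]; first exact: (submodule0 (Fsub _)).
    exact: (submoduleZD (Fsub _) k F1 F2).
  suff: [set g : A -> A | F (v + w).+1 (word u \o g)] g by [].
  apply: Fg; split=> [|_ [t [Lt st] <-]].
    apply/submoduleP; split=> [|k f1 f2 F1 F2] /=.
      have -> : word u \o (0 : A -> A) = 0.
        by apply/funext => x /=; rewrite (map0 (word_additive LA Lu)).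
      exact: (submodule0 (Fsub _)).
    have -> : word u \o (k *: f1 + f2) = k *: (word u \o f1) + (word u \o f2).
      by apply/funext => x /=; rewrite (wlin _ Lu).
    exact: (submoduleZD (Fsub _) k F1 F2).
  move=> T [_]; apply; exists (u ++ t).
    by rewrite /= all_cat Lu Lt size_cat; split=> //; lia.
  by apply/funext => x; rewrite word_cat.
exists F, n; split; last first.
  by move=> d Ld T [_]; apply; exists [:: d] => //=; rewrite mem_set.
split=> // [w|v w d e Fd Fe|].
- move=> f; apply; split; first exact: Fsub.
  by move=> _ [u [Lu su] <-] T [_]; apply; exists u => //; split=> //; apply: ltnW.
- have Fed : F (v + w).+1 (e \o d) by rewrite addnC; apply: comp Fe Fd.
  exact: (submoduleB (Fsub (v + w).+1) (comp _ _ _ _ Fd Fe) Fed).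
- move=> f; apply; split.
    by apply/submoduleP; split=> // k f1 f2 -> ->; rewrite scaler0 addr0.
  move=> _ [u [Lu su] <-]; apply/funext => x.
  by apply: (killed_by_words_ge LA Ln Lu); apply: ltnW.
Qed.

End Filtrations.

(** * Extending locally nilpotent Lie algebras *)

Section Extension.
Variables (Phi : comPzRingType) (A : comUnitAlgType Phi).
Implicit Types (d e f z : A -> A) (L J M X Y : set (A -> A)) (F : nat -> set (A -> A)).

Lemma bracket_jacobi d f g : linear d -> linear f -> linear g ->
  bracket d (bracket f g) = bracket (bracket d f) g + bracket f (bracket d g).
Proof.
move=> /linear_additive dA /linear_additive fA /linear_additive gA.
apply/funext => x; rewrite /bracket !fctE dA fA gA; ring.
Qed.

Lemma iter_bracketZD d k f g a : linear d ->
  iter a (bracket d) (k *: f + g) = k *: iter a (bracket d) f + iter a (bracket d) g.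
Proof. by move=> dl; elim: a => //= a ->; rewrite bracket_linearr. Qed.

Lemma iter_bracket0 d a : linear d -> iter a (bracket d) 0 = 0.
Proof. by move=> dl; elim: a => //= a ->; rewrite bracket0r. Qed.

Definition add_line J d := [set e | exists f k, J f /\ e = f + k *: d].

(** Let [(ad d) ^ N] kill the elements of [J] involved, and filter the Lie algebra
    generated by their images under the powers of [ad d]. Refining each step of this
    filtration into [N] steps leaves room for [ad d] to raise the weight: put [f] in
    the [w]-th term if [(ad d) ^ a f] lies in the old term of index [(w + a) / N], for
    all [a]. Then [d] can be added to the first term. *)
Lemma nilpotent_set_add_line J d : (forall f, J f -> linear f) -> linear d ->
    (forall f, J f -> J (bracket d f)) ->
    (forall f, J f -> exists N, forall k, (N <= k)%N -> iter k (bracket d) f = 0) ->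
    locally_nilpotent_set J ->
  locally_nilpotent_set (add_line J d).
Proof.
move=> Jlin dl dJ adnil Jnil Y finY YJ.
have /choice[jf jfP] : forall y, exists jf : (A -> A) * nat, Y y ->
    [/\ J jf.1, exists k, y = jf.1 + k *: d
      & forall k, (jf.2 <= k)%N -> iter k (bracket d) jf.1 = 0].
  move=> y; have [Yy|nYy] := pselect (Y y); last by exists (y, 0%N).
  have [f [k [Jf ->]]] := YJ y Yy; have [N NP] := adnil f Jf.
  by exists (f, N) => _; split=> //; exists k.
have /finite_seqP[s sE] := finY.
pose N := (\sum_(y <- s) (jf y).2).+1.
have NP y : Y y -> forall a, (N <= a)%N -> iter a (bracket d) (jf y).1 = 0.
  move=> Yy a Na; have [_ _] := jfP y Yy; apply.
  have ys : y \in s by move: Yy; rewrite sE.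
  by apply: leq_trans Na; rewrite leqW // (big_rem y ys) leq_addr.
pose X := [set iter a (bracket d) (jf y).1 | y in Y & a in `I_N].
have finX : finite_set X by apply: finite_image2 => //; exact: finite_II.
have XJ : X `<=` J.
  move=> _ [y /jfP[Jy _ _] [a _ <-]]; elim: a => //= a IH; exact: dJ.
have [F [n [FP XF]]] := Jnil X finX XJ.
have [Fsub Flin Fdec Fbr Fn] := FP.
pose G w := [set f | linear f /\ forall a, F ((w + a) %/ N)%N (iter a (bracket d) f)].
have Gsub w : submodule (G w).
  apply/submoduleP; split=> [|k f1 f2 [f1l G1] [f2l G2]].
    split=> [|a]; first exact: submodule0 (submodule_linear A).
    by rewrite iter_bracket0 //; exact: submodule0.
  split=> [|a]; first exact: (submoduleZD (submodule_linear A)).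
  by rewrite iter_bracketZD //; exact: submoduleZD.
have Gdec v w : (v <= w)%N -> G w `<=` G v.
  move=> vw f [fl Gf]; split=> // a.
  by apply: (nil_filtration_le FP) (Gf a); rewrite leq_div2r // leq_add2r.
have Gd w f : G w f -> G w.+1 (bracket d f).
  move=> [fl Gf]; split=> [|a]; first exact: bracket_linear.
  by rewrite addSnnS -iterSr; exact: Gf.
have Gbr v w f g : G v f -> G w g -> G (v + w).+1 (bracket f g).
  move=> Gf Gg; split=> [|a]; first exact: bracket_linear Gf.1 Gg.1.
  elim: a v w f g Gf Gg => [|a IH] v w f g Gf Gg.
    have [[fl Ff] [gl Fg]] := (Gf, Gg).
    have := Fbr _ _ _ _ (Ff 0%N) (Fg 0%N); rewrite !addn0 /=.
    apply: (nil_filtration_le FP); rewrite -ltnS ltn_divLR //.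
    have := divn_eq v N; have := divn_eq w N.
    have := ltn_pmod v (ltn0Sn (\sum_(y <- s) (jf y).2)).
    have := ltn_pmod w (ltn0Sn (\sum_(y <- s) (jf y).2)).
    rewrite -/N; nia.
  rewrite iterSr (bracket_jacobi dl Gf.1 Gg.1).
  rewrite -[X in _ (X + _)]scale1r iter_bracketZD // scale1r addnS.
  apply: (submoduleD (Fsub _)).
    by have := IH _ _ _ _ (Gd _ _ Gf) Gg; rewrite addSn addSn.
  by have := IH _ _ _ _ Gf (Gd _ _ Gg); rewrite addnS addSn.
pose H w := [set e | exists f k, [/\ G w f, w = 0%N \/ k = 0 & e = f + k *: d]].
exists H, (n * N).+1; split; last first.
  move=> y Yy; have [Jf [k yE] _] := jfP y Yy.
  exists (jf y).1, k; split=> //; [|by left]; split=> [|a]; first exact: Jlin.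
  have [Na|aN] := leqP N a; first by rewrite NP //; exact: submodule0.
  by rewrite add0n divn_small //; apply: XF; exists y => //; exists a.
split=> [w|w _ [f [k [[fl _] _ ->]]]|w|v w _ _ [f [k [Gf vk ->]]] [g [l [Gg wl ->]]]|].
- apply/submoduleP; split.
    exists 0, 0; split; [exact: submodule0 (Gsub _)|by right|by rewrite scale0r addr0].
  move=> h _ _ [f [k [Gf wk ->]]] [g [l [Gg wl ->]]].
  exists (h *: f + g), (h * k + l); split; first exact: (submoduleZD (Gsub _)).
    by case: wk => [->|->]; [left|case: wl => [->|->]; [left|right; rewrite mulr0 addr0]].
  by rewrite scalerDr addrACA scalerA scalerDl.
- rewrite addrC; exact: (submoduleZD (submodule_linear A)).
- move=> _ [f [k [Gf [//|k0] ->]]]; exists f, k; split=> //; last by right.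
  exact: Gdec Gf.
- exists (bracket (f + k *: d) (g + l *: d)), 0.
  split; [|by right|by rewrite scale0r addr0].
  have dg : G (v + w).+1 (k *: bracket d g).
    case: vk => [->|->]; first by apply/(submoduleZ (Gsub _))/Gd.
    by rewrite scale0r; exact: submodule0 (Gsub _).
  have df : G (v + w).+1 (l *: bracket d f).
    case: wl => [->|->]; first by rewrite addn0; apply/(submoduleZ (Gsub _))/Gd.
    by rewrite scale0r; exact: submodule0 (Gsub _).
  have -> : bracket (f + k *: d) (g + l *: d)
      = bracket f g + k *: bracket d g - l *: bracket d f.
    have [fl gl] := (Gf.1, Gg.1).
    have ldl : linear (g + l *: d).
      by rewrite addrC; exact: (submoduleZD (submodule_linear A)).
    rewrite addrC bracket_linearl // ![g + _]addrC !bracket_linearr // bracketdd.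
    by rewrite scaler0 add0r (bracketN f d) scalerN [RHS]addrAC addrC [- _ + _]addrC.
  apply: (submoduleB (Gsub _)) => //; apply: (submoduleD (Gsub _)) => //.
  exact: Gbr.
- move=> _ [f [k [[fl Gf] [//|k0] ->]]]; rewrite k0 scale0r addr0.
  have := Gf 0%N; rewrite addn0 => Ff; apply: Fn.
  apply: (nil_filtration_le FP) Ff; rewrite leq_divRL //; exact: leqW.
Qed.

End Extension.

(** * Ad-nilpotency and ascent along the derived series *)

Section LieAlgebra.
Variables (Phi : comPzRingType) (A : comUnitAlgType Phi).
Implicit Types (d e f z : A -> A) (L J M X Y : set (A -> A)).

Lemma Der_derivation L : L `<=` Der A -> derivations L.
Proof. by move=> LD d /LD[/linear_additive]. Qed.

Lemma lie_closed_bracket L : lie_closed L -> bracket_closed L.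
Proof. by case. Qed.

Section AdNilpotent.
Hypothesis torsion_free : forall (x : A) n, x *+ n.+1 = 0 -> x = 0.
Variables (L J : set (A -> A)) (d : A -> A).
Hypotheses (L_lie : lie_closed L) (LD : L `<=` Der A) (J_lie : lie_closed J).
Hypotheses (JL : J `<=` L) (Jnil : locally_nilpotent_set J) (Ld : L d).
Hypothesis dJ : forall f, J f -> J (bracket d f).

Lemma iter_ad z a : J z -> J (iter a (bracket d) z).
Proof. by move=> Jz; elim: a => //= a; exact: dJ. Qed.

(** As [J] is locally nilpotent and normalized by [d], the conjugate of [d] by the
    exponential of a multiple of [z] is [d] plus an element of [J], and lies in [L]. *)
Lemma nil_at_normalized z b : J z -> (forall e, L e -> nil_at e b) -> nil_at d (z b).
Proof.
move=> Jz bnil; have [Jsub Jbr] := J_lie; have [Lsub Lbr] := L_lie.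
have lin f : L f -> linear f by move=> /LD[].
pose D i := iter i (fun f => bracket f z) d.
have DJ i : J (D i.+1).
  elim: i => [|i IH]; first exact: dJ.
  by rewrite /D iterS; apply: Jbr.
have [||F [n [FP YF]]] :=
    Jnil (Y := [set z] `|` [set D 1%N]).
- by rewrite finite_setU; split; exact: finite_set1.
- by move=> f [->|->] //; exact: (DJ 0%N).
have [Fsub Flin Fdec Fbr Fn] := FP.
have DF i : F i (D i.+1).
  elim: i => [|i IH]; first by apply: YF; right.
  rewrite /D iterS -[i]addn0; apply: Fbr; first by rewrite addn0.
  by apply: YF; left.
have D0 i : (n < i)%N -> forall x, D i x = 0.
  case: i => // i ni x.
  by rewrite (Fn (D i.+1)) //; apply: (nil_filtration_le FP) (DF i).
have LDi i : L (D i) by case: i => [|i] //; exact: JL.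
apply: (@nil_at_of_conj_exp A z D n) => //.
- exact/linear_additive/lin/JL.
- by move=> i; apply/linear_additive/lin.
- by apply: bnil; exact: JL.
move=> t nt; apply: bnil.
have -> : conj_exp D n t = \sum_(i < n.+1) D i *+ (t ^ i %/ i`!).
  apply/funext => x; rewrite /conj_exp fct_sumE; apply: eq_bigr => i _.
  by elim: (_ %/ _)%N => [|k IH]; rewrite ?mulr0n // !mulrS IH.
elim/big_ind: _ => [|f g Lf Lg|i _].
- exact: submodule0.
- exact: submoduleD.
- exact: submoduleMn.
Qed.

Lemma nil_at_normalized_iter z b i : J z -> (forall e, L e -> nil_at e b) ->
  nil_at d (z (iter i d b)).
Proof.
move=> + bnil; elim: i z => [|i IH] z Jz; first exact: nil_at_normalized.
have dA := linear_additive (LD Ld).1.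
rewrite iterS.
have -> : z (d (iter i d b)) = d (z (iter i d b)) - bracket d z (iter i d b).
  by rewrite /bracket opprB addrC subrK.
apply: nil_atB => //; last by apply: IH; exact: dJ.
by have [n zn] := IH z Jz; exists n; rewrite -iterSr iterS zn (map0 dA).
Qed.

(** Expand [(ad d) ^ k z] into terms [d ^ a z d ^ i] with [a + i = k]. Either [d ^ i]
    kills [b], or [i] takes one of finitely many values and [d ^ a] kills [z (d ^ i b)]
    for large [a]. *)
Lemma ad_nil_at z b : J z -> (forall e, L e -> nil_at e b) ->
  exists N, forall k, (N <= k)%N -> iter k (bracket d) z b = 0.
Proof.
move=> Jz bnil; have dA := linear_additive (LD Ld).1.
have zA := linear_additive (LD (JL Jz)).1.
have [n bn] := bnil d Ld.
have /choice[m mP] : forall i, exists m, iter m d (z (iter i d b)) = 0.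
  by move=> i; exact: nil_at_normalized_iter.
pose M := (\sum_(i < n) m i)%N.
have h k a i : (n + M <= a + k + i)%N ->
    iter a d (iter k (bracket d) z (iter i d b)) = 0.
  elim: k a i => [|k IH] a i aki /=.
    have [ni|i_n] := leqP n i.
      by rewrite (iter_eq0 dA ni bn) (map0 zA) iter_map0.
    apply: (iter_eq0 dA) (mP i); apply: (@leq_trans M).
      by rewrite /M (bigD1 (Ordinal i_n)) //= leq_addr.
    by lia.
  rewrite /bracket (iter_additive dA) -iterSr -iterS.
  by rewrite !IH ?subrr //; lia.
by exists (n + M)%N => k nk; apply: (h k 0%N 0%N); lia.
Qed.

Lemma ad_nilpotent m (g : 'I_m -> A) z : generated_over (constants L) (range g) ->
    (forall j, tame L (range g) (g j)) -> J z ->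
  exists N, forall k, (N <= k)%N -> iter k (bracket d) z = 0.
Proof.
move=> gen gtame Jz.
have /choice[N NP] : forall j, exists N, forall k, (N <= k)%N ->
    iter k (bracket d) z (g j) = 0.
  move=> j; case: (gtame j) => [gnil|[s [_ gs snil]]]; first exact: ad_nil_at.
  have [N NP] := ad_nil_at Jz snil; exists N => k Nk.
  apply: (derivation_inverse0 (x := s)); [|by rewrite mulrC|exact: NP].
  by apply: (Der_derivation LD); apply/JL/iter_ad.
exists (\sum_j N j)%N => k Nk; apply/funext => x.
have kL : L (iter k (bracket d) z) by apply/JL/iter_ad.
have kD := Der_derivation LD kL.
move: x; apply: gen => [|x cx|_ [j _ <-]].
- have := subring_constants (L := [set iter k (bracket d) z]).
  case=> [e ->//|c1 cB cM]; split=> [|x y x0 y0|x y x0 y0].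
  + exact: c1.
  + by apply: cB => // e ->.
  + by apply: cM => // e ->.
- exact: cx.
- by apply: NP; apply: leq_trans Nk; rewrite (bigD1 j) //= leq_addr.
Qed.

End AdNilpotent.

(** Reach finitely many elements of [H] by adding them to [J] one at a time. The
    subspaces in between contain [J], hence all brackets of elements of [H], so they are
    Lie algebras normalized by the next element. *)
Lemma locally_nilpotent_set_of_brackets L H J m (g : 'I_m -> A) :
    (forall (x : A) n, x *+ n.+1 = 0 -> x = 0) -> lie_closed L -> L `<=` Der A ->
    generated_over (constants L) (range g) -> (forall j, tame L (range g) (g j)) ->
    lie_closed H -> H `<=` L -> lie_closed J -> J `<=` H ->
    (forall d e, H d -> H e -> J (bracket d e)) -> locally_nilpotent_set J ->
  locally_nilpotent_set H.
Proof.
move=> tf L_lie LD gen gtame [Hsub Hbr] HL J_lie JH brJ Jnil Y finY YH.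
have lin f : H f -> linear f by move=> /HL/LD[].
have [s sE] : exists s : seq (A -> A), Y = [set` s] by apply/finite_seqP.
suff [K [K_lie JK KH Knil sK]] : exists K, [/\ lie_closed K, J `<=` K, K `<=` H,
    locally_nilpotent_set K & [set` s] `<=` K] by apply: Knil; rewrite // sE.
have sH : [set` s] `<=` H by rewrite -sE.
elim: s {sE} sH => [|d s IH] sH; first by exists J; split.
have [|K [[Ksub Kbr] JK KH Knil sK]] := IH.
  by move=> f fs; apply: sH; rewrite /= inE (fs : f \in s) orbT.
have Hd : H d by apply: sH; rewrite /= mem_head.
have dK f : K f -> K (bracket d f) by move=> /KH Hf; apply/JK/brJ.
exists (add_line K d).
have lineH : add_line K d `<=` H.
  by move=> _ [f [k [Kf ->]]]; rewrite addrC; apply: (submoduleZD Hsub) => //; exact: KH.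
have Kline : K `<=` add_line K d by move=> f Kf; exists f, 0; rewrite scale0r addr0.
split=> // [|f /JK/Kline//||f].
- split.
    apply/submoduleP; split; first by apply: Kline; exact: (submodule0 Ksub).
    move=> h _ _ [f1 [k1 [K1 ->]]] [f2 [k2 [K2 ->]]].
    exists (h *: f1 + f2), (h * k1 + k2); split; first exact: (submoduleZD Ksub).
    by rewrite scalerDr addrACA scalerA scalerDl.
  by move=> e f /lineH He /lineH Hf; apply/Kline/JK/brJ.
- apply: nilpotent_set_add_line => // [f /KH/lin//||f Kf]; first exact: lin.
  apply: (@ad_nilpotent tf L K d L_lie LD (conj Ksub Kbr) _ Knil _ dK m g) => //.
    by move=> e /KH/HL.
  exact: HL.
- rewrite /= inE => /predU1P[->|/sK/Kline//].
  by exists 0, 1; rewrite scale1r add0r; split=> //; exact: (submodule0 Ksub).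
Qed.

End LieAlgebra.

Section Solvable.
Variables (Phi : comPzRingType) (A : comUnitAlgType Phi) (L : set (A -> A)).
Hypotheses (L_lie : lie_closed L) (LD : L `<=` Der A).

Definition derived_span k := smallest (@submodule Phi A) (derived_brackets L k).
Local Notation D := derived_span.

Lemma derived_brackets_le k : derived_brackets L k.+1 `<=` derived_brackets L k.
Proof.
elim: k => [|k IH].
  by rewrite derived_bracketsSr => _ [d Ld] [e Le <-]; exact: (L_lie.2).
rewrite derived_bracketsSr [in X in _ `<=` X]derived_bracketsSr.
by move=> _ [d /IH Dd] [e /IH De <-]; exists d => //; exists e.
Qed.

Lemma derived_span_sub k : derived_brackets L k `<=` D k.
Proof. by move=> d Ld T [_]; apply. Qed.

Lemma derived_span_in_L k : D k `<=` L.
Proof.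
move=> d; apply; split; first exact: L_lie.1.
by elim: k => // k IH f /derived_brackets_le /IH.
Qed.

Lemma derived_span_le k : D k.+1 `<=` D k.
Proof.
move=> d; apply; split; first exact: submodule_smallest.
by move=> f /derived_brackets_le; exact: derived_span_sub.
Qed.

Lemma derived_span_bracket k d e : D k d -> D k e -> D k.+1 (bracket d e).
Proof.
have Dsub : submodule (D k.+1) by exact: submodule_smallest.
have lin f : D k f -> linear f by move=> /derived_span_in_L/LD[].
move=> Dd De.
suff: [set d | D k.+1 (bracket d e)] d by [].
apply: Dd; split=> [|{}d Ld].
  apply/submoduleP; split=> [|c f g Df Dg] /=.
    by rewrite bracket0l; [exact: (submodule0 Dsub)|exact: lin].
  by rewrite bracket_linearl; [exact: (submoduleZD Dsub)|exact: lin].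
have dl := lin d (derived_span_sub Ld).
suff: [set e | D k.+1 (bracket d e)] e by [].
apply: De; split=> [|{}e Le].
  apply/submoduleP; split=> [|c f g Df Dg] /=.
    by rewrite bracket0r //; exact: (submodule0 Dsub).
  by rewrite bracket_linearr //; exact: (submoduleZD Dsub).
by apply: derived_span_sub; rewrite derived_bracketsSr; exists d => //; exists e.
Qed.

Lemma derived_span_lie k : lie_closed (D k).
Proof.
split; first exact: submodule_smallest.
by move=> d e Dd De; apply: derived_span_le; exact: derived_span_bracket.
Qed.

Lemma locally_nilpotent_set0 : locally_nilpotent_set [set (0 : A -> A)].
Proof.
move=> Y _ Y0; exists (fun=> [set 0]), 0%N; split=> //.
have sub0 : submodule [set (0 : A -> A)].
  by apply/submoduleP; split=> // k d e -> ->; rewrite scaler0 addr0.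
split=> [//|w f ->|w f //|v w d e -> ->|//].
  exact: (submodule0 (submodule_linear A)).
exact: bracketdd.
Qed.

Theorem locally_nilpotent_set_char0 m (g : 'I_m -> A) :
    GRing.integral_domain_axiom A -> (forall n, (n.+1%:R : A) != 0) ->
    generated_over (constants L) (range g) -> (forall j, tame L (range g) (g j)) ->
  locally_nilpotent_set L.
Proof.
move=> A_domain char0 gen gtame.
have tf (x : A) n : x *+ n.+1 = 0 -> x = 0.
  by rewrite -mulr_natl; apply: domain_eq0.
have Dm : D m `<=` [set 0].
  move=> d; apply; split.
    by apply/submoduleP; split=> // k f1 f2 -> ->; rewrite scaler0 addr0.
  move=> f Lf; apply/funext => x.
  exact: (derived_brackets_char0 A_domain char0 (Der_derivation LD)
    (lie_closed_bracket L_lie) gen gtame Lf).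
have Dnil k : (k <= m)%N -> locally_nilpotent_set (D (m - k)).
  elim: k => [|k IH] km.
    rewrite subn0 => Y finY YD; apply: locally_nilpotent_set0 => //.
    exact: subset_trans YD Dm.
  have mk : (m - k = (m - k.+1).+1)%N by rewrite -subSn.
  have IHk := IH (ltnW km); rewrite mk in IHk.
  apply: (locally_nilpotent_set_of_brackets tf L_lie LD gen gtame _ _ _ _ _ IHk).
  - exact: derived_span_lie.
  - exact: derived_span_in_L.
  - exact: derived_span_lie.
  - exact: derived_span_le.
  - exact: derived_span_bracket.
have := Dnil m (leqnn m); rewrite subnn => D0 Y finY YL; apply: D0 => //.
by move=> f /YL Lf; exact: derived_span_sub.
Qed.

Theorem nilpotent_set_pchar p m (g : 'I_m -> A) :
    GRing.integral_domain_axiom A -> (0 < p)%N -> (p%:R : A) = 0 ->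
    generated_over (constants L) (range g) -> (forall j, tame L (range g) (g j)) ->
  nilpotent_set L.
Proof.
move=> A_domain p_gt0 p0 gen gtame; have LD' := Der_derivation LD.
have [n dep] := dependent_over_pchar A_domain p_gt0 p0 LD' gen.
apply: (@killed_by_words_nilpotent_set Phi A L n) => [d /LD[]//|].
apply: (engel A_domain (derivations_additive LD') (linear_over_constants LD')
  (lie_closed_bracket L_lie)) => // d Ld.
have dD := LD' d Ld.
apply: gen => [|x cx|_ [j _ <-]]; first exact: subring_nil_at.
  by exists 1%N; exact: cx.
case: (gtame j) => [|[s [_ gs snil]]]; first exact.
by apply: (nil_at_inverse p_gt0 p0 dD (x := s)); [rewrite mulrC|exact: snil].
Qed.

End Solvable.

(** * Generators coming from an order *)

Lemma domain_char (R : comNzRingType) : GRing.integral_domain_axiom R ->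
  (exists2 p, (0 < p)%N & (p%:R : R) = 0) \/ (forall n, (n.+1%:R : R) != 0).
Proof.
move=> R_domain; have [|nch] := pselect (exists2 p, (0 < p)%N & (p%:R : R) = 0).
  by left.
by right=> n; apply/eqP => n0; apply: nch; exists n.+1.
Qed.

(** Each generator is a quotient [s^-1 * b] of elements of the order; replace it by
    [s], [s^-1] and [b]. *)
Lemma order_tame_generators (Phi : comPzRingType) (A : comUnitAlgType Phi)
    (L : set (A -> A)) : L `<=` Der A -> fin_gen_algebra A -> is_order (nil_part L) ->
  exists m (g : 'I_m -> A), generated_over (constants L) (range g) /\
    forall j, tame L (range g) (g j).
Proof.
move=> LD [G finG genG] [_ [S [SB _ Sunit Sfrac]]].
have /choice[q qP] : forall a, exists q : A * A,
    [/\ S q.1, nil_part L q.2 & a = q.1^-1 * q.2].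
  by move=> a; have [s [b [Ss Bb ab]]] := Sfrac a; exists (s, b).
pose E := (fun a => (q a).1) @` G `|` (fun a => (q a).1^-1) @` G
  `|` (fun a => (q a).2) @` G.
have /finite_seqP[h hE] : finite_set E.
  by rewrite !finite_setU; do !split; apply: finite_image.
pose g (j : 'I_(size h)) := nth 0 h j.
have gE : range g = E.
  rewrite hE; apply/seteqP; split=> [_ [j _ <-]|x xh]; first exact: mem_nth.
  have xi : (index x h < size h)%N by rewrite index_mem.
  by exists (Ordinal xi) => //; rewrite /g /= nth_index.
have nil_atL x : nil_part L x -> forall d, L d -> nil_at d x.
  by move=> Lx d Ld; have [n _ nx] := Lx d Ld; exists n.
exists (size h), g; split=> [T TS CT gT|j].
  have Tscal k : T (k *: 1).
    apply: CT => d Ld; have [dl dM] := LD d Ld.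
    by rewrite (linearZ_map k 1 dl) (derivation1 (Der_derivation LD Ld)) scaler0.
  have Tsub : subalgebra T.
    split=> [|k a b|a b]; rewrite ?in_setE; first exact: (subring1 TS).
      move=> Ta Tb; rewrite -[a]mul1r scalerAl; apply: (subringD TS) => //.
      exact: (subringM TS).
    exact: (subringM TS).
  have ET : E `<=` T by rewrite -gE.
  have GT : G `<=` T.
    move=> a Ga; have [_ _ ->] := qP a.
    by apply: (subringM TS); apply: ET; [left; right; exists a|right; exists a].
  move=> x; have : smallest (@subalgebra Phi A) G x by rewrite genG.
  by apply.
have : E (g j) by rewrite -gE; exists j.
have sE a : G a -> range g (q a).1 by move=> Ga; rewrite gE; left; left; exists a.
case=> [[|]|] [a Ga <-]; have [Sa Ba _] := qP a.
- by left; apply/nil_atL/SB.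
- right; exists (q a).1; split; [exact: sE|exact/mulVr/Sunit|exact/nil_atL/SB].
- by left; apply: nil_atL.
Qed.

Theorem proposition1p6 (Phi : comPzRingType) (A : comUnitAlgType Phi)
    (A_fin_gen : fin_gen_algebra A)
    (A_domain : GRing.integral_domain_axiom A)
    (L : set (A -> A)) (L_lie : lie_subalgebra L (Der A))
    (AL_order : is_order (nil_part L)) :
  locally_nilpotent L.
Proof.
have [LD Lie] := L_lie.
have [m [g [gen gtame]]] := order_tame_generators LD A_fin_gen AL_order.
move=> M [ML _] [X finX MX].
have XL : X `<=` L.
  by move=> d Xd; apply: ML; rewrite MX => T [_]; apply.
rewrite MX; apply: nilpotent_set_lie_nilpotent.
have [[p p_gt0 p0]|char0] := domain_char A_domain.
  exact: nilpotent_set_sub XL (nilpotent_set_pchar Lie LD A_domain p_gt0 p0 gen gtame).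
exact: (locally_nilpotent_set_char0 Lie LD A_domain char0 gen gtame).
Qed.
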